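(* There is no quartic number field $K$ such that the number of elliptic curves $E$ over $K$ with $\mathbb{Z}/4\mathbb{Z}\oplus\mathbb{Z}/8\mathbb{Z}$ isomorphic to a subgroup of $E(K)$ is positive and finite.
   Context: Elliptic curves are counted up to isomorphism over $\overline{K}$. *)

(* Defs.v *)
From HB Require Import structures.
From mathcomp Require Import all_boot all_order all_algebra all_field.
From mathcomp Require Import boolp classical_sets functions cardinality.
From mathcomp Require Import ring.

Set Implicit Arguments.
Unset Strict Implicit.
Unset Printing Implicit Defensive.

Import GRing.Theory.
Local Open Scope ring_scope.

(* Elliptic curves over a field F are given by (general) Weierstrass equations
     y^2 + a1 x y + a3 y = x^3 + a2 x^2 + a4 x + a6
   with nonzero discriminant. *)
Record weierstrass (F : Type) : Type := Weierstrass {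
  wa1 : F; wa2 : F; wa3 : F; wa4 : F; wa6 : F }.

Definition map_weierstrass (F L : Type) (h : F -> L) (W : weierstrass F) :
    weierstrass L :=
  Weierstrass (h (wa1 W)) (h (wa2 W)) (h (wa3 W)) (h (wa4 W)) (h (wa6 W)).

Definition disc (F : fieldType) (W : weierstrass F) : F :=
  let: Weierstrass a1 a2 a3 a4 a6 := W in
  let b2 := a1 ^+ 2 + 4%:R * a2 in
  let b4 := 2%:R * a4 + a1 * a3 in
  let b6 := a3 ^+ 2 + 4%:R * a6 in
  let b8 := a1 ^+ 2 * a6 + 4%:R * a2 * a6 - a1 * a3 * a4 + a2 * a3 ^+ 2
            - a4 ^+ 2 in
  - b2 ^+ 2 * b8 - 8%:R * b4 ^+ 3 - 27%:R * b6 ^+ 2 + 9%:R * b2 * b4 * b6.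

Record ellcurve (F : fieldType) : Type := EllCurve {
  ec_weierstrass :> weierstrass F;
  ec_disc : disc ec_weierstrass != 0 }.

(* [None] is the point at infinity. *)
Definition oncurve (F : fieldType) (W : weierstrass F) (P : option (F * F)) :
    bool :=
  if P is Some (x, y) then
    y ^+ 2 + wa1 W * x * y + wa3 W * y
      == x ^+ 3 + wa2 W * x ^+ 2 + wa4 W * x + wa6 W
  else true.

(* Chord-and-tangent addition. For points of the curve with x1 = x2, the first
   test says that the second point is the opposite of the first; if it fails
   then y1 = y2 and [l] is the slope of the tangent. *)
Definition wadd (F : fieldType) (W : weierstrass F) (P Q : option (F * F)) :
    option (F * F) :=
  match P, Q with
  | None, _ => Q
  | _, None => P
  | Some (x1, y1), Some (x2, y2) =>
    if (x1 == x2) && (y1 + y2 + wa1 W * x2 + wa3 W == 0) then None else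
    let l :=
      if x1 == x2 then
        (3%:R * x1 ^+ 2 + 2%:R * wa2 W * x1 + wa4 W - wa1 W * y1)
          / (2%:R * y1 + wa1 W * x1 + wa3 W)
      else (y2 - y1) / (x2 - x1) in
    let x3 := l ^+ 2 + wa1 W * l - wa2 W - x1 - x2 in
    Some (x3, - (l * (x3 - x1) + y1) - wa1 W * x3 - wa3 W)
  end.

Lemma wadd_oncurve (F : fieldType) (W : weierstrass F) (P Q : option (F * F)) :
  oncurve W P -> oncurve W Q -> oncurve W (wadd W P Q).
Proof.
case: W => a1 a2 a3 a4 a6; rewrite /oncurve /wadd /=.
case: P => [[x1 y1]|] //; case: Q => [[x2 y2]|] // /eqP e1 /eqP e2.
pose f x y := x ^+ 3 + a2 * x ^+ 2 + a4 * x + a6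
              - (y ^+ 2 + a1 * x * y + a3 * y).
have f1 : f x1 y1 = 0 by rewrite /f e1 subrr.
have f2 : f x2 y2 = 0 by rewrite /f e2 subrr.
have [e|ne] := eqVneq x1 x2 => /=.
  subst x2; case: ifPn => // nopp.
  have : (y1 - y2) * (y1 + y2 + a1 * x1 + a3) = 0.
    have -> : (y1 - y2) * (y1 + y2 + a1 * x1 + a3) = f x1 y2 - f x1 y1.
      by rewrite /f; ring.
    by rewrite f1 f2 subrr.
  move/eqP; rewrite mulf_eq0 (negbTE nopp) orbF subr_eq0 => /eqP e; subst y2.
  have nd : 2%:R * y1 + a1 * x1 + a3 != 0.
    by move: nopp; congr (_ != 0); ring.
  set l := _ / _.
  have fl : 3%:R * x1 ^+ 2 + 2%:R * a2 * x1 + a4 - a1 * y1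
            = l * (2%:R * y1 + a1 * x1 + a3) by rewrite /l divfK.
  have f3 : f (l ^+ 2 + a1 * l - a2 - x1 - x1)
              (l * (l ^+ 2 + a1 * l - a2 - x1 - x1 - x1) + y1) = 0.
    transitivity (f x1 y1 + (l ^+ 2 + a1 * l - a2 - x1 - x1 - x1)
      * (3%:R * x1 ^+ 2 + 2%:R * a2 * x1 + a4 - a1 * y1
         - l * (2%:R * y1 + a1 * x1 + a3))).
      by rewrite /f; ring.
    by rewrite f1 fl subrr mulr0 addr0.
  by rewrite -subr_eq0 -oppr_eq0 -[X in _ == X]f3; apply/eqP; rewrite /f; ring.
set l := _ / _.
have nd : x2 - x1 != 0 by rewrite subr_eq0 eq_sym.
have fl : y2 = y1 + l * (x2 - x1) by rewrite /l divfK // addrC subrK.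
set x3 := l ^+ 2 + a1 * l - a2 - x1 - x2.
have f3 : f x3 (l * (x3 - x1) + y1) = 0.
  apply/(mulIf nd); rewrite mul0r.
  transitivity (f x1 y1 * (x2 - x3) + f x2 y2 * (x3 - x1)).
    by rewrite /f fl /x3; ring.
  by rewrite f1 f2 !mul0r addr0.
by rewrite -subr_eq0 -oppr_eq0 -[X in _ == X]f3; apply/eqP; rewrite /f; ring.
Qed.

Definition ecpoint (F : fieldType) (E : ellcurve F) : Type :=
  {P : option (F * F) | oncurve E P}.

Definition ecadd (F : fieldType) (E : ellcurve F) (P Q : ecpoint E) :
    ecpoint E :=
  exist _ (wadd E (sval P) (sval Q)) (wadd_oncurve (svalP P) (svalP Q)).

(* A (finite) abelian group G is isomorphic to a subgroup of E(F) iff there is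
   an injective homomorphism from G to E(F). *)
Definition embeds_in_points (G : zmodType) (F : fieldType) (E : ellcurve F) :
    Prop :=
  exists f : G -> ecpoint E,
    injective f /\ {morph f : g h / g + h >-> ecadd g h}.

(* W' is obtained from W by the admissible change of variables
     x = u^2 x' + r,  y = u^3 y' + u^2 s x' + t. *)
Definition weierstrass_isom (F : fieldType) (W W' : weierstrass F) : Prop :=
  let: Weierstrass a1 a2 a3 a4 a6 := W in
  let: Weierstrass a1' a2' a3' a4' a6' := W' in
  exists u r s t : F, u != 0 /\
    [/\ u * a1' = a1 + 2%:R * s,
        u ^+ 2 * a2' = a2 - s * a1 + 3%:R * r - s ^+ 2,
        u ^+ 3 * a3' = a3 + r * a1 + 2%:R * t,
        u ^+ 4 * a4' = a4 - s * a3 + 2%:R * r * a2 - (t + r * s) * a1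
                       + 3%:R * r ^+ 2 - 2%:R * s * t
      & u ^+ 6 * a6' = a6 + r * a4 + r ^+ 2 * a2 + r ^+ 3 - t * a3 - t ^+ 2
                       - r * t * a1].

Definition geom_isom (F L : fieldType) (iota : F -> L) (E E' : ellcurve F) :
    Prop :=
  weierstrass_isom (map_weierstrass iota E) (map_weierstrass iota E').

(* The set of L-isomorphism classes (as sets of elliptic curves over F)
   represented by an elliptic curve over F satisfying P. *)
Definition geom_isom_classes (F L : fieldType) (iota : F -> L)
    (P : ellcurve F -> Prop) : set (set (ellcurve F)) :=
  [set C | exists2 E, P E & C = [set E' | geom_isom iota E E']]%classic.

(* Main.v *)
(* A curve with a subgroup Z/4 x Z/8 has its 4-torsion and a point of order 8
   over K; halving points by extraction of square roots, this gives a point of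
     b^2 = 1 + a^2,  c^2 = 1 - a^2,  a (a^4 - 1) <> 0   (a model of X_1(4,8)),
   and a square root of -1.  Duplication on this genus-one curve sends a to
   a' = 2abc/(1 + a^4).  For a valuation |.| of K above 2:  |a'| < |a| when
   |a| < 1, and |a'| < 1 when |a| > 1; when |a| = 1 one also gets |a'| < 1,
   unless K contains t with |t|^8 = |2|, which would force [K : Q] >= 8.
   So one noncuspidal point yields points a_0, a_1, ... with |a_n| < 1 strictly
   decreasing.  Each of them gives back a curve y^2 = x (x + 1) (x + a_n^4)
   with a subgroup Z/4 x Z/8, and the valuations of the j-invariants of these
   curves are pairwise distinct. *)

Require Import Defs.
From mathcomp Require Import all_boot all_order all_algebra all_field.
From mathcomp Require Import boolp classical_sets functions cardinality.
From mathcomp Require Import ring.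

Set Implicit Arguments.
Unset Strict Implicit.
Unset Printing Implicit Defensive.

Import GRing.Theory.
Local Open Scope ring_scope.

(** An embedding of Z/4 x Z/8 is a homomorphism for chord-and-tangent addition, so constructing one
    on y^2 = x (x + 1) (x + a^4) requires commutativity and associativity. These are proved for a1 =
    a3 = 0, which covers that family. The opposite passage, from an embedding to a point (a, b, c),
    uses only doubling relations, and the given homomorphism supplies them on any Weierstrass
    equation. Comparing sizes replaces a study of the rank and torsion of the genus-one curve: an
    orbit along which |a| strictly decreases cannot repeat. The valuation comes from a maximal
    subring without 1/2, and |x| <= |y| means divisibility in it, so neither prime ideals nor a
    value group appear. The delicate case is |a| = 1, where 1 + a^4 may be as small as the numerator
    of a'. There the sizes of b, c, 1 - a and c - a + 1 have to be pinned down one after the other.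
    The degree of K enters at one place, to refute |t|^8 = |2|. *)

(** * The group law *)

(* The coefficients of the curve are eliminated: [A] is read off the second
   divided difference of y^2 at x1, x2, x3.  When x1 = x2, [l] is the slope of
   a tangent. *)
Section ChordComputation.

Variables (F : fieldType) (x1 x2 x3 y2 l k A y1 y3 x4 y4 x6 y6 m p : F).

Lemma chord_assoc :
  y1 = y2 - l * (x2 - x1) ->
  y3 = y2 + k * (x3 - x2) ->
  A = (k * (y2 + y3) - l * (y1 + y2)) / (x3 - x1) - (x1 + x2 + x3) ->
  x4 = l ^+ 2 - A - x1 - x2 ->
  y4 = - (l * (x4 - x1) + y1) ->
  x6 = k ^+ 2 - A - x2 - x3 ->
  y6 = - (k * (x6 - x2) + y2) ->
  m = (y3 - y4) / (x3 - x4) ->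
  p = (y6 - y1) / (x6 - x1) ->
  x3 - x1 != 0 -> x3 - x4 != 0 -> x6 - x1 != 0 ->
  let x5 := m ^+ 2 - A - x4 - x3 in
  let x7 := p ^+ 2 - A - x1 - x6 in
  (x5, - (m * (x5 - x4) + y4)) = (x7, - (p * (x7 - x1) + y1)).
Proof.
move=> Ey1 Ey3 EA Ex4 Ey4 Ex6 Ey6 Em Ep.
rewrite {}Em {}Ep {}Ey6 {}Ey4 {}Ex6 {}Ex4 {}EA {}Ey3 {}Ey1 => d1 d2 d3 /=.
(* [A] has denominator x3 - x1, so x6 - x1 and x3 - x4 become polynomials only after multiplication
   by it; [field] asks for these products. *)
have := mulf_neq0 d3 d1; have := mulf_neq0 d2 d1 => e2 e3.
by congr pair; field; apply/and3P; (split=> //; [move: e3|move: e2]);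
  congr (_ != 0); field.
Qed.

End ChordComputation.

Section GroupLaw.

Variables (F : fieldType) (A B C : F).

Let W := Weierstrass 0 A 0 B C.

Definition ptopp (P : option (F * F)) :=
  if P is Some (x, y) then Some (x, - y) else None.

(** Coefficients of the identity x^3 + A x^2 + B x + C - (l x + n)^2 = (x - x1) (x - x2) (x - x3).
    Since multiplicities are allowed, chords and tangents are treated alike. *)
Definition on_line l n x1 x2 x3 :=
  [/\ A = l ^+ 2 - (x1 + x2 + x3),
      B = 2%:R * l * n + (x1 * x2 + x1 * x3 + x2 * x3)
    & C = n ^+ 2 - x1 * x2 * x3].

Definition nonsingular :=
  forall x, x ^+ 3 + A * x ^+ 2 + B * x + C = 0 ->
            3%:R * x ^+ 2 + 2%:R * A * x + B != 0.

Hypothesis F2 : 2%:R != 0 :> F.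

Lemma wadd0P P : wadd W None P = P. Proof. by []. Qed.

Lemma oncurveE x y :
  oncurve W (Some (x, y)) = (y ^+ 2 == x ^+ 3 + A * x ^+ 2 + B * x + C).
Proof. by rewrite /= !mul0r !addr0. Qed.

Lemma oncurve_opp P : oncurve W (ptopp P) = oncurve W P.
Proof. by case: P => [[x y]|] //; rewrite [ptopp _]/= !oncurveE sqrrN. Qed.

Lemma wadd_opp P : wadd W P (ptopp P) = None.
Proof. by case: P => [[x y]|] //=; rewrite eqxx !mul0r !addr0 subrr eqxx. Qed.

Lemma wadd_chord x1 y1 x2 y2 : x1 != x2 ->
  let l := (y2 - y1) / (x2 - x1) in
  let x3 := l ^+ 2 - A - x1 - x2 in
  wadd W (Some (x1, y1)) (Some (x2, y2)) = Some (x3, - (l * (x3 - x1) + y1)).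
Proof. by move=> /negPf ne /=; rewrite ne /= !mul0r !addr0 !subr0. Qed.

Lemma ptoppP P Q : oncurve W P -> oncurve W Q ->
  omap fst P = omap fst Q -> P = Q \/ P = ptopp Q.
Proof.
case: P Q => [[x y]|] [[x' y']|] //; last by left.
rewrite !oncurveE => /eqP e /eqP e' [exx]; subst x'.
have /eqP : (y - y') * (y + y') = 0 by rewrite -subr_sqr e e' subrr.
rewrite mulf_eq0 subr_eq0 addr_eq0 => /orP [] /eqP ->; [by left|by right].
Qed.

Lemma add_on_line l n x1 x2 x3 : on_line l n x1 x2 x3 ->
  ~~ ((x1 == x2) && (l * x1 + n + (l * x2 + n) == 0)) ->
  wadd W (Some (x1, l * x1 + n)) (Some (x2, l * x2 + n))
    = Some (x3, - (l * x3 + n)).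
Proof.
move=> [eA eB eC] nopp.
have ex3 : x3 = l ^+ 2 - A - x1 - x2 by rewrite eA; ring.
case: (eqVneq x1 x2) => [e|ne].
  subst x2; rewrite eqxx /= in nopp; rewrite /= eqxx !mul0r !addr0 (negPf nopp).
  have -> : (3%:R * x1 ^+ 2 + 2%:R * A * x1 + B - 0)
      / (2%:R * (l * x1 + n)) = l.
    have d : 2%:R * (l * x1 + n) != 0 by move: nopp; congr (_ != 0); ring.
    by apply/(canLR (mulfK d)); rewrite eA eB; ring.
  by rewrite !subr0 -ex3; congr (Some (_, _)); ring.
rewrite wadd_chord //; have d : x2 - x1 != 0 by rewrite subr_eq0 eq_sym.
have -> : (l * x2 + n - (l * x1 + n)) / (x2 - x1) = l by field.
by rewrite -ex3; congr (Some (_, _)); ring.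
Qed.

Lemma exists_line x1 y1 x2 y2 :
  oncurve W (Some (x1, y1)) -> oncurve W (Some (x2, y2)) ->
  ~~ ((x1 == x2) && (y1 + y2 == 0)) ->
  exists l n x3, [/\ y1 = l * x1 + n, y2 = l * x2 + n & on_line l n x1 x2 x3].
Proof.
rewrite !oncurveE => /eqP e1 /eqP e2.
case: (eqVneq x1 x2) => [e|ne] /= nopp.
  subst x2; have : (y1 - y2) * (y1 + y2) = 0 by rewrite -subr_sqr e1 e2 subrr.
  move/eqP; rewrite mulf_eq0 (negPf nopp) orbF subr_eq0 => /eqP e; subst y2.
  have d : y1 != 0.
    by apply: contraNneq nopp => ->; rewrite addr0.
  pose l := (3%:R * x1 ^+ 2 + 2%:R * A * x1 + B) / (2%:R * y1).
  exists l, (y1 - l * x1), (l ^+ 2 - A - x1 - x1); split; try ring.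
  have eC : C = y1 ^+ 2 - (x1 ^+ 3 + A * x1 ^+ 2 + B * x1) by rewrite e1; ring.
  by split; rewrite ?eC /l; field; rewrite d F2.
pose l := (y2 - y1) / (x2 - x1).
have d : x2 - x1 != 0 by rewrite subr_eq0 eq_sym.
have eB : B = (y2 ^+ 2 - y1 ^+ 2) / (x2 - x1)
              - (x1 ^+ 2 + x1 * x2 + x2 ^+ 2) - A * (x1 + x2).
  by rewrite e1 e2; field.
have eC : C = y1 ^+ 2 - (x1 ^+ 3 + A * x1 ^+ 2 + B * x1) by rewrite e1; ring.
exists l, (y1 - l * x1), (l ^+ 2 - A - x1 - x2).
split; [ring|by rewrite /l; field|split; first by ring].
  by rewrite eB /l; field.
by rewrite eC eB /l; field.
Qed.

Lemma on_lineC l n x1 x2 x3 : on_line l n x1 x2 x3 -> on_line l n x2 x1 x3.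
Proof. by case=> eA eB eC; split; rewrite ?eA ?eB ?eC; ring. Qed.

Lemma waddC P Q : oncurve W P -> oncurve W Q -> wadd W P Q = wadd W Q P.
Proof.
case: P Q => [[x1 y1]|] [[x2 y2]|] // oP oQ.
have [/andP[/eqP <- /eqP e]|nopp] :=
    boolP ((x1 == x2) && (y1 + y2 == 0)).
  by rewrite /= !eqxx !mul0r !addr0 [y2 + y1]addrC e eqxx.
have [l [n [x3 [e1 e2 L]]]] := exists_line oP oQ nopp.
rewrite e1 e2 in nopp *; rewrite (add_on_line L nopp).
by rewrite (add_on_line (on_lineC L)) // eq_sym [l * x2 + n + _]addrC.
Qed.

Hypothesis ns : nonsingular.

(** Reflecting the line through P, Q and -(P + Q) gives the line through P + Q, -Q and -P.
    Nonsingularity excludes the degenerate case P + Q = Q. *)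
Lemma waddK P Q : oncurve W P -> oncurve W Q ->
  wadd W (wadd W P Q) (ptopp Q) = P.
Proof.
case: P Q => [[x1 y1]|] [[x2 y2]|] // oP oQ; last first.
  by rewrite wadd0P wadd_opp.
have [/andP[/eqP <- e]|nopp] := boolP ((x1 == x2) && (y1 + y2 == 0)).
  rewrite /= eqxx !mul0r !addr0 e /=.
  by move: e; rewrite addr_eq0 => /eqP ->.
have [l [n [x3 [e1 e2 L]]]] := exists_line oP oQ nopp.
rewrite e1 e2 in nopp *; rewrite (add_on_line L nopp) /=.
have L' : on_line (- l) (- n) x3 x2 x1.
  by case: L => eA eB eC; split; rewrite ?eA ?eB ?eC; ring.
have -> : - (l * x3 + n) = - l * x3 - n by ring.
have -> : - (l * x2 + n) = - l * x2 - n by ring.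
rewrite [LHS](_ : _ = wadd W (Some (x3, - l * x3 - n)) (Some (x2, - l * x2 - n))) //.
rewrite (add_on_line L'); first by congr (Some (_, _)); ring.
(* Here the line would meet the curve twice at a point with y = 0, which makes [x2] a double root of
   the cubic. *)
apply/negP => /andP[/eqP e3 /eqP z]; subst x3.
case: L => eA eB eC.
have y0 : l * x2 + n = 0.
  by apply: (mulfI F2); rewrite mulr0 -oppr0 -z; ring.
have f0 : x2 ^+ 3 + A * x2 ^+ 2 + B * x2 + C = 0.
  by move: oQ; rewrite oncurveE e2 y0 expr0n => /eqP <-.
move/eqP: (ns f0); apply.
transitivity (2%:R * l * (l * x2 + n)); last by rewrite y0 mulr0.
by rewrite eA eB; ring.
Qed.

Lemma ptoppD P Q : oncurve W P -> oncurve W Q ->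
  ptopp (wadd W P Q) = wadd W (ptopp P) (ptopp Q).
Proof.
case: P Q => [[x1 y1]|] [[x2 y2]|] // oP oQ.
have [/andP[/eqP <- /eqP e]|nopp] := boolP ((x1 == x2) && (y1 + y2 == 0)).
  have eN : - y1 - y2 = 0 by rewrite -opprD e oppr0.
  by rewrite /= !eqxx !mul0r !addr0 e eN eqxx.
have [l [n [x3 [e1 e2 L]]]] := exists_line oP oQ nopp.
rewrite e1 e2 in nopp *; rewrite (add_on_line L nopp).
have LN : on_line (- l) (- n) x1 x2 x3.
  by case: L => eA eB eC; split; rewrite ?eA ?eB ?eC; ring.
have /(add_on_line LN) : ~~ ((x1 == x2) &&
    (- l * x1 + - n + (- l * x2 + - n) == 0)).
  by rewrite !mulNr -!opprD oppr_eq0.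
rewrite !mulNr -!opprD !opprK => e.
by transitivity (Some (x3, l * x3 + n)); [rewrite /= opprK|rewrite -e].
Qed.

(** On the curve this says P = Q or P = -Q; the point at infinity shares its abscissa only with
    itself. *)
Definition same_abscissa (P Q : option (F * F)) := omap fst P == omap fst Q.

Lemma same_abscissa_opp P : same_abscissa (ptopp P) P.
Proof. by case: P => [[x y]|]; rewrite /same_abscissa /=. Qed.

Lemma oncurve_wadd P Q : oncurve W P -> oncurve W Q -> oncurve W (wadd W P Q).
Proof. exact: wadd_oncurve. Qed.

(** The conditions make every addition except P + Q a chord: Q + M = P would mean M = P - Q, and Q +
    M = -P would mean M = -(P + Q). The sum P + Q itself may need a tangent or vanish. *)
Lemma waddA_generic P Q M : oncurve W P -> oncurve W Q -> oncurve W M ->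
  M != None -> ~~ same_abscissa M P -> ~~ same_abscissa M Q ->
  ~~ same_abscissa M (wadd W P Q) ->
  ~~ same_abscissa M (wadd W P (ptopp Q)) ->
  wadd W (wadd W P Q) M = wadd W P (wadd W Q M).
Proof.
case: P => [[x1 y1]|] //; case: Q => [[x2 y2]|] //.
case: M => [[x3 y3]|] // oP oQ oM _ fP fQ fS fD.
have [opp|nopp] := boolP ((x1 == x2) && (y1 + y2 == 0)).
  have -> : Some (x1, y1) = ptopp (Some (x2, y2)).
    by move: opp; rewrite addr_eq0 => /= /andP[/eqP -> /eqP ->].
  have oN : oncurve W (ptopp (Some (x2, y2))) by rewrite oncurve_opp.
  rewrite [wadd W (ptopp _) (Some (x2, y2))]waddC // wadd_opp wadd0P.
  by rewrite [RHS]waddC ?oncurve_wadd // [wadd W (Some (x2, _)) _]waddC // waddK.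
have ne13 : x3 - x1 != 0.
  by rewrite subr_eq0; apply: contraNneq fP => ->; exact: eqxx.
have ne23 : x2 != x3.
  by apply: contraNneq fQ => ->; exact: eqxx.
have d32 : x3 - x2 != 0 by rewrite subr_eq0 eq_sym.
have UM : wadd W (Some (x2, y2)) (Some (x3, y3)) = _ := wadd_chord y2 y3 ne23.
move: UM; set k := (y3 - y2) / (x3 - x2).
set x6 := k ^+ 2 - _ - _ - _; set y6 := - (_ + y2) => UM.
have ne16 : x1 != x6.
  apply/eqP => e16; have oU : oncurve W (Some (x6, y6)) by rewrite -UM oncurve_wadd.
  have MU : Some (x3, y3) = wadd W (Some (x6, y6)) (ptopp (Some (x2, y2))).
    by rewrite -UM [wadd W (Some (x2, _)) _]waddC // waddK.
  have [|e|e] := @ptoppP (Some (x6, y6)) (Some (x1, y1)) oU oP.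
  - by rewrite /= e16.
  - by case/negP: fD; rewrite MU e /same_abscissa.
  - case/negP: fS; rewrite MU e -ptoppD //; exact: same_abscissa_opp.
rewrite UM [RHS]wadd_chord //.
have [l [n [x4 [e1 e2 L]]]] := exists_line oP oQ nopp.
have SM : wadd W (Some (x1, y1)) (Some (x2, y2)) = Some (x4, - (l * x4 + n)).
  by rewrite e1 e2; apply: add_on_line; rewrite -?e1 -?e2.
have ne43 : x4 != x3.
  by apply: contraNneq fS => <-; rewrite SM; exact: eqxx.
rewrite SM [LHS]wadd_chord //; congr Some.
case: L => eA eB eC.
have y3E : y3 = y2 + k * (x3 - x2) by rewrite /k; field.
apply: (@chord_assoc F x1 x2 x3 y2 l k A y1 y3 x4) => //.
- by rewrite e1 e2; ring.
- have eM : y3 ^+ 2 = x3 ^+ 3 + A * x3 ^+ 2 + B * x3 + C.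
    by move: oM; rewrite oncurveE => /eqP.
  (* Both lines pass through Q, so y3 - l x3 - n = (k - l) (x3 - x2), while y3^2 - (l x3 + n)^2
     factors by [on_line]; the common factor x3 - x2 cancels. *)
  have e3 : (k - l) * (y3 + l * x3 + n) = (x3 - x1) * (x3 - x4).
    apply: (mulIf d32).
    transitivity ((y3 - l * x3 - n) * (y3 + l * x3 + n)).
      by rewrite {2}y3E e2; ring.
    transitivity (y3 ^+ 2 - (l * x3 + n) ^+ 2); first by ring.
    by rewrite eM eA eB eC; ring.
  apply: (canRL (addrK _)); apply: (canRL (mulfK ne13)).
  transitivity ((x3 - x1) * (x3 - x4) + l ^+ 2 * (x3 - x1)).
    by rewrite eA; ring.
  by rewrite -e3 y3E e1 e2; ring.
- by rewrite eA; ring.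
- by rewrite e1; ring.
- by rewrite subr_eq0 eq_sym.
- by rewrite subr_eq0 eq_sym.
Qed.

End GroupLaw.

(** * Associativity over an algebraically closed field *)

Section ClosedField.

Variables (F : closedFieldType) (A B C : F).
Hypotheses (F2 : 2%:R != 0 :> F) (ns : nonsingular A B C).

Let W := Weierstrass 0 A 0 B C.

Lemma exists_avoiding (s : seq (option (F * F))) :
  exists M, [/\ oncurve W M, M != None & all (fun P => ~~ same_abscissa M P) s].
Proof.
(* A root of the product plus 1 lies outside [xs]; the extra entry 0 keeps the product nonconstant
   when [s] has no affine point. *)
pose xs := 0 :: pmap (omap fst) s.
pose p := \prod_(x <- xs) ('X - x%:P) + 1.
have szp : size p != 1%N.
  by rewrite size_polyDl size_prod_XsubC ?size_poly1 //= ltnS.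
have /closed_rootP [x rx] := szp.
have nx : x \notin xs.
  apply/negP => xin; move: rx; rewrite rootE hornerD hornerC.
  have : root (\prod_(x <- xs) ('X - x%:P)) x by rewrite root_prod_XsubC.
  by rewrite rootE => /eqP ->; rewrite add0r oner_eq0.
pose c := x ^+ 3 + A * x ^+ 2 + B * x + C.
have /closed_rootP [y] : size ('X^2 - c%:P) != 1%N by rewrite size_XnsubC.
rewrite rootE !hornerE subr_eq0 => ry.
exists (Some (x, y)); split=> //; first by rewrite oncurveE.
apply/allP => -[[x' y']|] // xin; apply: contra nx => /eqP [->].
by rewrite inE mem_pmap; apply/orP; right; apply/mapP; exists (Some (x', y')).
Qed.

(* For M outside a finite set, every addition of M is a chord in general
   position, and M can be cancelled at the end. *)
Lemma waddA P Q R : oncurve W P -> oncurve W Q -> oncurve W R ->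
  wadd W (wadd W P Q) R = wadd W P (wadd W Q R).
Proof.
move=> oP oQ oR.
have oN Z : oncurve W Z -> oncurve W (ptopp Z) by rewrite oncurve_opp.
have oD := @oncurve_wadd _ A B C.
pose S := wadd W P Q; pose T := wadd W Q R.
have oS : oncurve W S by apply: oD.
have oT : oncurve W T by apply: oD.
pose ok X Y := [:: X; Y; wadd W X Y; wadd W X (ptopp Y)].
(* R + M must also be generic for P and Q and differ from infinity. Since R + M = Z or -Z means M =
   Z - R or -Z - R, these points are avoided too. *)
pose moved := flatten [seq [:: wadd W Z (ptopp R); wadd W (ptopp Z) (ptopp R)]
                      | Z <- None :: ok P Q].
have [M [oM M0]] := exists_avoiding (ok S R ++ ok Q R ++ ok P T ++ moved).
rewrite 3!all_cat => /and4P[okSR okQR okPT okm].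
have gen X Y N : oncurve W X -> oncurve W Y -> oncurve W N -> N != None ->
    all (fun Z => ~~ same_abscissa N Z) (ok X Y) ->
    wadd W (wadd W X Y) N = wadd W X (wadd W Y N).
  by move=> oX oY oN' N0 /and5P[? ? ? ? _]; apply: waddA_generic.
have cancel X Y : oncurve W X -> oncurve W Y -> wadd W X M = wadd W Y M -> X = Y.
  by move=> oX oY /(congr1 (fun Z => wadd W Z (ptopp M))); rewrite !waddK.
have okm' Z : oncurve W Z -> Z \in None :: ok P Q ->
    ~~ same_abscissa (wadd W R M) Z.
  move=> oZ Zin; apply/negP => /eqP e.
  have eM Y : oncurve W Y -> wadd W R M = Y -> M = wadd W Y (ptopp R).
    by move=> oY <-; rewrite [wadd W R M]waddC // waddK.
  have mem Y : Y \in [:: wadd W Z (ptopp R); wadd W (ptopp Z) (ptopp R)] ->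
      ~~ same_abscissa M Y.
    move=> Yin; move/allP: okm; apply; apply/flattenP.
    by eexists; [apply: map_f Zin|].
  have [|/eM|/eM] := @ptoppP _ A B C (wadd W R M) Z _ oZ e; rewrite ?oD //.
  - by move=> /(_ oZ) eMZ; case/negP: (mem _ (mem_head _ _)); rewrite eMZ /same_abscissa.
  - move=> /(_ (oN _ oZ)) eMZ.
    by have := mem M; rewrite {1}eMZ !inE eqxx orbT /same_abscissa eqxx => /(_ isT).
have RM0 : wadd W R M != None by apply: contra (okm' None isT (mem_head _ _)) => /eqP ->.
have okRM : all (fun Z => ~~ same_abscissa (wadd W R M) Z) (ok P Q).
  apply/allP => Z Zin; apply: okm'; last by rewrite inE Zin orbT.
  by move: Zin; rewrite !inE => /or4P[] /eqP ->; rewrite ?oD ?oN.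
(* After adding M, both sides become P + (Q + (R + M)). *)
by apply: cancel; rewrite ?oD // gen // gen ?oD // [RHS]gen // [in RHS]gen.
Qed.

End ClosedField.

Lemma wadd_map (F L : fieldType) (h : {rmorphism F -> L}) (W : weierstrass F)
    (P Q : option (F * F)) :
  let hp := omap (fun p => (h p.1, h p.2)) in
  hp (wadd W P Q) = wadd (map_weierstrass h W) (hp P) (hp Q).
Proof.
case: W => a1 a2 a3 a4 a6; case: P Q => [[x1 y1]|] [[x2 y2]|] //=.
rewrite (fmorph_eq h) -!rmorphM -!rmorphD (fmorph_eq0 h).
case: ifP => //= _; case: ifP => _;
  by congr (Some (_, _)); rewrite !(rmorph_nat, rmorphXn, rmorphB, rmorphN, rmorphD, rmorphM, fmorphV).
Qed.

(** * Associativity over a subfield *)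

Section Descent.

Variables (F : fieldType) (L : closedFieldType) (iota : {rmorphism F -> L}).
Variables (A B C : F).
Hypotheses (L2 : 2%:R != 0 :> L) (ns : nonsingular (iota A) (iota B) (iota C)).

Lemma waddA_descent P Q R : let W := Weierstrass 0 A 0 B C in
  oncurve W P -> oncurve W Q -> oncurve W R ->
  wadd W (wadd W P Q) R = wadd W P (wadd W Q R).
Proof.
move=> W oP oQ oR; pose hp := omap (fun p : F * F => (iota p.1, iota p.2)).
have hpI : injective hp.
  by case=> [[x y]|] [[x' y']|] //= [] /fmorph_inj -> /fmorph_inj ->.
have hpW P1 Q1 : hp (wadd W P1 Q1) =
    wadd (Weierstrass 0 (iota A) 0 (iota B) (iota C)) (hp P1) (hp Q1).
  by rewrite /hp wadd_map /map_weierstrass /= rmorph0.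
have hpo P1 : oncurve W P1 ->
    oncurve (Weierstrass 0 (iota A) 0 (iota B) (iota C)) (hp P1).
  case: P1 => [[x y]|] //; rewrite [hp _]/= !oncurveE => /eqP e.
  by rewrite -rmorphXn e !(rmorphD, rmorphM, rmorphXn).
by apply: hpI; rewrite !hpW waddA // hpo.
Qed.

End Descent.

(** * Embedding Z/4 x Z/8 by two elements *)

Section CyclicProduct.

Variables (T : Type) (op : T -> T -> T) (e : T).
Hypotheses (opA : associative op) (opC : commutative op) (op0 : left_id e op).

Let mul x n := iter n (op x) e.

Lemma iter_opD x m n : mul x (m + n) = op (mul x m) (mul x n).
Proof. elim: m => [|m IH]; first by rewrite op0.
by rewrite addSn /mul !iterS -opA; congr op. Qed.

Lemma iter_op_mod x d n : mul x d = e -> mul x (n %% d) = mul x n.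
Proof.
move=> xd; rewrite {2}(divn_eq n d) iter_opD.
suff -> k : mul x (k * d) = e by rewrite op0.
by elim: k => // k IH; rewrite mulSn iter_opD xd IH op0.
Qed.

(** A nonzero subgroup of Z/4 x Z/8 contains one of the three elements of order 2, so three
    inequalities suffice for injectivity. Differences are taken in the source, because [op] comes
    without inverses. *)
Lemma embed_Z4_Z8 (P Q : T) : mul Q 4 = e -> mul P 8 = e ->
  mul Q 2 <> e -> mul P 4 <> e -> mul Q 2 <> mul P 4 ->
  exists f : 'Z_4 * 'Z_8 -> T,
    injective f /\ {morph f : g h / g + h >-> op g h}.
Proof.
move=> Q4 P8 Q2 P4 QP; pose f (g : 'Z_4 * 'Z_8) := op (mul Q g.1) (mul P g.2).
have fD : {morph f : g h / g + h >-> op g h}.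
  move=> [a b] [c d]; rewrite /f /=.
  have -> : mul Q (a + c)%R = mul Q (a + c)%N by rewrite -[RHS](iter_op_mod _ Q4).
  have -> : mul P (b + d)%R = mul P (b + d)%N by rewrite -[RHS](iter_op_mod _ P8).
  by rewrite !iter_opD -!opA; congr op; rewrite !opA; congr op; apply: opC.
have f0 : f 0 = e by rewrite /f /= op0.
have dbl g : f g = e -> f (g + g) = e by move=> fg; rewrite fD fg op0.
have f20 : f (2%:R, 0) <> e by rewrite /f [op _ _]opC op0.
have f04 : f (0, 4%:R) <> e by rewrite /f op0.
have f24 : f (2%:R, 4%:R) <> e.
  rewrite /f /= => fe; apply: QP.
  by rewrite -[LHS]op0 opC -P8 (iter_opD P 4 4) opA fe op0.
have ker g : f g = e -> g = 0.
  case: g => [[m lm] [n ln]] fg.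
  have fg2 := dbl _ fg; have fg4 := dbl _ fg2.
  have F0 h : h = (2%:R, 0) \/ h = (0, 4%:R) \/ h = (2%:R, 4%:R) -> f h <> e.
    by case=> [|[]] ->.
  have eqZ (h h' : 'Z_4 * 'Z_8) :
      (h.1 == h'.1 :> nat) && (h.2 == h'.2 :> nat) -> h = h'.
    by case: h h' => [? ?] [? ?] /andP[/= /eqP/val_inj -> /eqP/val_inj ->].
  (* For each nonzero g among the 32 elements, one of g, 2g, 4g has order 2, and [f] would send it
     to [e]. *)
  by do 4?[case: m lm fg fg2 fg4 => [|m] lm fg fg2 fg4 //];
    do 8?[case: n ln fg fg2 fg4 => [|n] ln fg fg2 fg4 //];
    first [exact: eqZ
      | by case: (F0 _ _ fg); first [left; exact: eqZ|right; left; exact: eqZ|right; right; exact: eqZ]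
      | by case: (F0 _ _ fg2); first [left; exact: eqZ|right; left; exact: eqZ|right; right; exact: eqZ]
      | by case: (F0 _ _ fg4); first [left; exact: eqZ|right; left; exact: eqZ|right; right; exact: eqZ]].
exists f; split=> // g h fgh; apply/eqP; rewrite -subr_eq0; apply/eqP/ker.
by rewrite fD fgh -fD subrr.
Qed.

End CyclicProduct.

(** * A valuation above 2 *)

Section ValuationRing.

Variable K : fieldType.

Definition subring_set (A : set K) :=
  [/\ A 1, forall x y, A x -> A y -> A (x - y) & forall x y, A x -> A y -> A (x * y)].

(** Excluding 1/2 makes 2 a non-unit, so the residue characteristic is 2. *)
Definition valuation_ring_over2 (A : set K) :=
  [/\ subring_set A, forall x, A x \/ A x^-1 & ~ A 2%:R^-1].

Section Subring.

Variable A : set K.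
Hypothesis subA : subring_set A.

Lemma sub_set0 : A 0.
Proof. by case: subA => A1 AB _; rewrite -(subrr 1); apply: AB. Qed.

Lemma sub_setN x : A x -> A (- x).
Proof. by case: subA => _ AB _ Ax; rewrite -sub0r; apply: AB => //; apply: sub_set0. Qed.

Lemma sub_setD x y : A x -> A y -> A (x + y).
Proof.
by case: subA => _ AB _ Ax Ay; rewrite -[y]opprK; apply: AB => //; apply: sub_setN.
Qed.

Lemma sub_set_sum I (r : seq I) (P : pred I) (f : I -> K) :
  (forall i, P i -> A (f i)) -> A (\sum_(i <- r | P i) f i).
Proof. by move=> Af; apply: big_ind => //; [apply: sub_set0|apply: sub_setD]. Qed.

Lemma sub_setX x n : A x -> A (x ^+ n).
Proof.
case: subA => A1 _ AM Ax; elim: n => [|n IH]; first by rewrite expr0.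
by rewrite exprS; apply: AM.
Qed.

Lemma sub_set_int (n : int) : A n%:~R.
Proof.
case: subA => A1 _ _; have An k : A k%:R.
  by elim: k => [|k IH]; [apply: sub_set0|rewrite -natr1; apply: sub_setD].
by case: n => n; [apply: An|rewrite NegzE rmorphN; apply/sub_setN/An].
Qed.

Definition adjoin (x : K) : set K :=
  [set y | exists2 p : {poly K}, (forall i, A p`_i) & y = p.[x]]%classic.

Lemma adjoin_subring x : subring_set (adjoin x).
Proof.
case: (subA) => A1 AB AM; split.
- exists 1; last by rewrite hornerC.
  by move=> i; rewrite coef1; case: eqP => _ //; apply: sub_set0.
- move=> _ _ [p Ap ->] [q Aq ->]; exists (p - q); last by rewrite !hornerE.
  by move=> i; rewrite coefB; apply: AB.
- move=> _ _ [p Ap ->] [q Aq ->]; exists (p * q); last by rewrite hornerM.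
  by move=> i; rewrite coefM; apply: sub_set_sum => j _; apply: AM.
Qed.

Lemma sub_adjoin x : (A `<=` adjoin x)%classic.
Proof.
move=> y Ay; exists y%:P; last by rewrite hornerC.
by move=> i; rewrite coefC; case: ifP => _ //; apply: sub_set0.
Qed.

Lemma mem_adjoin x : adjoin x x.
Proof.
case: (subA) => A1 _ _; exists 'X; last by rewrite hornerX.
by move=> i; rewrite coefX; case: eqP => _ //; apply: sub_set0.
Qed.

End Subring.

Hypothesis K0 : forall n : nat, n.+1%:R != 0 :> K.

Lemma exists_maximal_subring : exists A : set K, [/\ subring_set A, ~ A 2%:R^-1 &
  forall B, subring_set B -> (A `<=` B)%classic -> ~ B 2%:R^-1 -> (B `<=` A)%classic].
Proof.
have K2 : 2%:R != 0 :> K := K0 1.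
pose good (A : set K) := A = set0%classic \/ subring_set A /\ ~ A 2%:R^-1.
have [F goodF totF|A [goodA maxA]] := @Zorn_bigcup K good.
  have [[X FX [X0 X2]]|nX] := pselect (exists2 X, F X & subring_set X /\ ~ X 2%:R^-1).
    right; have sub Y y : F Y -> Y y -> subring_set Y /\ ~ Y 2%:R^-1.
      by move=> FY Yy; case: (goodF _ FY) => // Y0; rewrite Y0 in Yy.
    have both x y : (\bigcup_(X in F) X)%classic x -> (\bigcup_(X in F) X)%classic y ->
        exists Y, [/\ F Y, subring_set Y, Y x & Y y].
      move=> [Y FY Yx] [Z FZ Zy]; have [sY _] := sub _ _ FY Yx.
      have [sZ _] := sub _ _ FZ Zy.
      have [YZ|ZY] := totF _ _ FY FZ; [exists Z|exists Y]; split=> //.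
        exact: YZ.
      exact: ZY.
    split; last by move=> [Y FY Y2]; case: (sub _ _ FY Y2).
    split; first by exists X => //; case: X0.
      by move=> x y /both H /H [Y [FY [_ YB _] Yx Yy]]; exists Y => //; apply: YB.
    by move=> x y /both H /H [Y [FY [_ _ YM] Yx Yy]]; exists Y => //; apply: YM.
  left; rewrite -subset0 => x [X FX Xx]; case: (goodF _ FX) => [X0|gX].
    by rewrite X0 in Xx.
  by apply: nX; exists X.
have max B : subring_set B -> (A `<=` B)%classic -> ~ B 2%:R^-1 -> (B `<=` A)%classic.
  move=> sB AB B2; have [//|nBA] := pselect (B `<=` A)%classic.
  by case: (maxA B); [split|right].
case: goodA => [A0|[sA A2]]; last by exists A.
pose Z := [set x : K | exists n : int, x = n%:~R]%classic.
have sZ : subring_set Z.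
  split; first by exists 1.
    by move=> _ _ [m ->] [n ->]; exists (m - n); rewrite rmorphB.
  by move=> _ _ [m ->] [n ->]; exists (m * n); rewrite rmorphM.
have Z2 : ~ Z 2%:R^-1.
  move=> [n en]; have e1 : (2 * n - 1)%:~R = 0 :> K.
    by rewrite rmorphB rmorphM /= -en divff // subrr.
  have [k [ek|ek]] : exists k : nat, 2 * n - 1 = k.+1%:Z \/ 2 * n - 1 = - k.+1%:Z.
    case E : (2 * n - 1)%R => [[|k]|k]; last by exists k; right; rewrite -NegzE.
      by move/eqP: E; rewrite subr_eq0 => /eqP /(congr1 absz); rewrite abszM => /(congr1 odd); rewrite oddM.
    by exists k; left.
  - move: (K0 k); have -> : k.+1%:R = (2 * n - 1)%:~R :> K by rewrite ek.
    by rewrite e1 eqxx.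
  - move: (K0 k); rewrite -oppr_eq0.
    have -> : - k.+1%:R = (2 * n - 1)%:~R :> K by rewrite ek rmorphN.
    by rewrite e1 eqxx.
have := max Z sZ; rewrite A0 => /(_ (@sub0set _ _) Z2 1) [].
by exists 1.
Qed.

(* A maximal subring without 1/2 is a valuation ring. *)
Lemma exists_valuation_ring : exists A, valuation_ring_over2 A.
Proof.
have K2 : 2%:R != 0 :> K := K0 1.
have [A [sA A2 maxA]] := exists_maximal_subring; exists A; split=> //.
case: (sA) => A1 AB AM; have At : A 2%:R := sub_set_int sA 2.
(* By maximality it is enough that A[1/s] misses 1/2: from 1/2 = a / s^k and s^k = 1 - 2 b one gets
   1/2 = a + b in A. *)
have inv s : (exists2 a, A a & s = 1 - 2%:R * a) -> A s^-1 /\ s != 0.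
  move=> sa; have s0 : s != 0.
    case: sa => a Aa ->; rewrite subr_eq0; apply/eqP => e; apply: A2.
    suff -> : 2%:R^-1 = a by [].
    by apply: (mulfI K2); rewrite mulfV // -e.
  have sX k : exists2 a, A a & s ^+ k = 1 - 2%:R * a.
    case: sa => a Aa es; elim: k => [|k [b Ab IH]].
      by exists 0; [apply: sub_set0|rewrite mulr0 subr0].
    exists (a + b - 2%:R * a * b); last by rewrite exprS IH es; ring.
    apply: AB; first exact: sub_setD.
    by do 2!apply: (AM) => //.
  split=> //; pose B := [set x | exists a k, A a /\ x = a / s ^+ k]%classic.
  have As : A s by case: sa => a Aa ->; apply: AB => //; apply: AM.
  have AX k : A (s ^+ k) by apply: sub_setX.
  have sX0 k : s ^+ k != 0 by rewrite expf_neq0.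
  apply: (maxA B); last by exists 1, 1%N; rewrite div1r.
  - split; first by exists 1, 0%N; rewrite divr1.
      move=> _ _ [a [k [Aa ->]]] [b [l [Ab ->]]].
      exists (a * s ^+ l - b * s ^+ k), (k + l)%N; split; first by apply: AB; apply: AM.
      by rewrite exprD; field; rewrite !sX0.
    move=> _ _ [a [k [Aa ->]]] [b [l [Ab ->]]].
    exists (a * b), (k + l)%N; split; first exact: AM.
    by rewrite exprD; field; rewrite !sX0.
  - by move=> a Aa; exists a, 0%N; rewrite divr1.
  - move=> [a [k [Aa e]]]; have [b Ab eb] := sX k.
    have e2 : s ^+ k = 2%:R * a.
      by apply: (mulIf (invr_neq0 (sX0 k))); rewrite mulfV // -mulrA -e mulfV.
    apply: A2; have -> : 2%:R^-1 = a + b; last exact: sub_setD.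
    apply: (mulfI K2); rewrite mulfV // mulrDr -e2 eb; ring.
(* 1/2 is a polynomial in x of degree at most n over A. If neither x nor 1/x lies in A, both have
   such a relation, and the two can be shortened against each other down to degree 0. *)
pose rep x n := exists2 a : nat -> K, (forall i, A (a i)) &
  \sum_(i < n.+1) a i * x ^+ i = 2%:R^-1.
have repP x : ~ A x -> exists n, rep x n.
  move=> nAx; have [[p Ap e]|n2] := pselect (adjoin A x 2%:R^-1); last first.
    by case: nAx; apply: (maxA _ (adjoin_subring sA x) (sub_adjoin sA x) n2); apply: mem_adjoin.
  exists (size p), (fun i => p`_i) => //.
  by rewrite e -(horner_coef_wide x (leqnSn _)).
have repW x m n : (m <= n)%N -> rep x m -> rep x n.
  move=> mn [a Aa e]; exists (fun i => if (i <= m)%N then a i else 0).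
    by move=> i; case: ifP => _ //; apply: sub_set0.
  rewrite -e (big_ord_widen n.+1 (fun i => a i * x ^+ i)) // [RHS]big_mkcond.
  by apply: eq_bigr => i _; rewrite ltnS; case: ifP => _ //; rewrite mul0r.
(* Multiplying the relation for 1/x by x^(n+1) expresses (1/2 - b_0) x^(n+1) by lower powers of x.
   As 1 - 2 b_0 is a unit of A, the leading term of the relation for x can be replaced. *)
have dec x n : x != 0 -> rep x n.+1 -> rep x^-1 n.+1 -> rep x n.
  move=> x0 [a Aa ea] [b Ab eb].
  have [Ai s0] : A (1 - 2%:R * b 0%N)^-1 /\ 1 - 2%:R * b 0%N != 0.
    by apply: inv; exists (b 0%N).
  set s := 1 - _ in Ai s0.
  exists (fun i => a i + 2%:R * s^-1 * a n.+1 * b (n.+1 - i)%N).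
    move=> i; apply: sub_setD => //; by do 3!apply: (AM) => //.
  have eb' : \sum_(i < n.+1) b (n.+1 - i)%N * x ^+ i = s / 2%:R * x ^+ n.+1.
    rewrite (reindex_inj rev_ord_inj) /=.
    have -> : s / 2%:R = \sum_(i < n.+1) b i.+1 * x^-1 ^+ i.+1.
      move: eb; rewrite big_ord_recl expr0 mulr1 => /(canRL (addKr _)).
      rewrite /bump /= => ->; rewrite /s; field; exact: K2.
    rewrite mulr_suml; apply: eq_bigr => i _.
    have le : (i.+1 <= n.+1)%N by [].
    rewrite subKn // exprVn -mulrA; congr (_ * _).
    have -> : x ^+ n.+1 = x ^+ (n.+1 - i.+1) * x ^+ i.+1 by rewrite -exprD subnK.
    by rewrite mulrCA mulVf ?mulr1 // expf_neq0.
  rewrite -ea [in RHS]big_ord_recr /=.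
  rewrite (eq_bigr (fun i : 'I_n.+1 => a i * x ^+ i
     + 2%:R * s^-1 * a n.+1 * (b (n.+1 - i)%N * x ^+ i))); last by move=> i _; ring.
  rewrite big_split /= -mulr_sumr eb'; congr (_ + _); field.
  by rewrite s0 K2.
have no x : ~ A x -> ~ A x^-1 -> forall n, rep x n -> rep x^-1 n -> False.
  move=> nx nx'; have x0 : x != 0 by apply: contra_notN nx => /eqP ->; apply: sub_set0.
  elim=> [|n IH] r r'.
    case: r => a Aa; rewrite big_ord1 expr0 mulr1 => e; apply: A2; rewrite -e; exact: Aa.
  apply: IH; first exact: dec.
  by apply: dec; rewrite ?invr_eq0 ?invrK.
move=> x; have [|nx] := pselect (A x); first by left.
have [|nx'] := pselect (A x^-1); first by right.
have [[m rm] [n rn]] := (repP _ nx, repP _ nx').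
by case: (no _ nx nx' (maxn m n)); [apply: repW rm; rewrite leq_maxl|apply: repW rn; rewrite leq_maxr].
Qed.

End ValuationRing.

(** * Absolute values as divisibility, and the size of the duplicated point *)

Section Valuation.

Variables (K : fieldType) (O : set K).
Hypotheses (K0 : forall n : nat, n.+1%:R != 0 :> K) (VO : valuation_ring_over2 O).

Let sO : subring_set O. Proof. by case: VO. Qed.
Let OM x y : O x -> O y -> O (x * y). Proof. by case: sO => _ _; apply. Qed.
Let K2 : 2%:R != 0 :> K. Proof. exact: K0. Qed.

(* [vle x y] stands for |x| <= |y|, where |.| is the absolute value defined
   by the valuation ring [O]. *)
Definition vle (x y : K) := exists2 o, O o & x = o * y.
Definition vlt x y := ~ vle y x.
Definition veq x y := vle x y /\ vle y x.

Lemma vle_refl x : vle x x.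
Proof. by case: sO => O1 _ _; exists 1; rewrite ?mul1r. Qed.

Lemma vle_trans y x z : vle x y -> vle y z -> vle x z.
Proof. by move=> [o Oo ->] [u Ou ->]; exists (o * u); rewrite ?mulrA //; apply: OM. Qed.

Lemma vle_total x y : vle x y \/ vle y x.
Proof.
have [->|y0] := eqVneq y 0.
  by right; exists 0; rewrite ?mul0r //; apply: sub_set0.
have [->|x0] := eqVneq x 0.
  by left; exists 0; rewrite ?mul0r //; apply: sub_set0.
case: VO => _ /(_ (x / y)) [Oxy|Oyx] _; [left|right].
  by exists (x / y); rewrite ?divfK.
by exists (y / x); rewrite ?divfK // -invf_div.
Qed.

Lemma vltW x y : vlt x y -> vle x y.
Proof. by move=> ?; case: (vle_total x y). Qed.

Lemma vle_lt_trans y x z : vle x y -> vlt y z -> vlt x z.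
Proof. by move=> xy yz zx; apply: yz; apply: vle_trans zx xy. Qed.

Lemma vlt_le_trans y x z : vlt x y -> vle y z -> vlt x z.
Proof. by move=> xy yz zx; apply: xy; apply: vle_trans yz zx. Qed.

Lemma vlt_trans y x z : vlt x y -> vlt y z -> vlt x z.
Proof. by move=> xy /vltW; apply: vlt_le_trans. Qed.

Lemma vle0 x : vle 0 x.
Proof. by exists 0; rewrite ?mul0r //; apply: sub_set0. Qed.

Lemma vlt_neq0 x y : vlt x y -> y != 0.
Proof. by move=> xy; apply: contra_notN xy => /eqP ->; apply: vle0. Qed.

Lemma vle_mul x y z w : vle x y -> vle z w -> vle (x * z) (y * w).
Proof. by move=> [o Oo ->] [u Ou ->]; exists (o * u); [apply: OM|ring]. Qed.

Lemma vle_pmul2r z x y : z != 0 -> vle (x * z) (y * z) -> vle x y.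
Proof. by move=> z0 [o Oo e]; exists o => //; apply: (mulIf z0); rewrite e mulrA. Qed.

Lemma vlt_le_mul x y z w : vlt x y -> vle z w -> w != 0 -> vlt (x * z) (y * w).
Proof.
move=> xy zw w0 le; apply: xy; apply: (vle_pmul2r w0).
by apply: vle_trans le _; apply: vle_mul => //; apply: vle_refl.
Qed.

Lemma vle_add x y z : vle x z -> vle y z -> vle (x + y) z.
Proof. by move=> [o Oo ->] [u Ou ->]; exists (o + u); [apply: sub_setD|ring]. Qed.

Lemma vle_opp x y : vle x y -> vle (- x) y.
Proof. by move=> [o Oo ->]; exists (- o); [apply: sub_setN|ring]. Qed.

Lemma vle_exp n x y : vle x y -> vle (x ^+ n) (y ^+ n).
Proof.
by move=> xy; elim: n => [|n IH]; rewrite ?exprS; [apply: vle_refl|apply: vle_mul].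
Qed.

Lemma vlt_sqr x y : vlt x y -> vlt (x ^+ 2) (y ^+ 2).
Proof. by move=> xy; rewrite !expr2; apply: vlt_le_mul (vltW xy) (vlt_neq0 xy). Qed.

Lemma vlt_sqr_inv x y : vlt (x ^+ 2) (y ^+ 2) -> vlt x y.
Proof. by move=> xy yx; apply: xy; apply: vle_exp. Qed.

Lemma vle_sqr_inv x y : vle (x ^+ 2) (y ^+ 2) -> vle x y.
Proof. by move=> xy; case: (pselect (vle x y)) => // /vlt_sqr. Qed.

Lemma vlt21 : vlt 2%:R 1.
Proof.
move=> [o Oo e]; case: VO => _ _; apply; suff -> : 2%:R^-1 = o by [].
by apply: (mulIf K2); rewrite mulVf.
Qed.

Lemma vle_int1 (n : int) : vle n%:~R 1.
Proof. by exists n%:~R; rewrite ?mulr1 //; apply: sub_set_int. Qed.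

Lemma veq_refl x : veq x x.
Proof. by split; apply: vle_refl. Qed.

Lemma veq_sym x y : veq x y -> veq y x.
Proof. by case. Qed.

Lemma veq_trans y x z : veq x y -> veq y z -> veq x z.
Proof. by move=> [? ?] [? ?]; split; apply: (@vle_trans y). Qed.

Lemma veq_mul x y z w : veq x y -> veq z w -> veq (x * z) (y * w).
Proof. by move=> [? ?] [? ?]; split; apply: vle_mul. Qed.

Lemma veq_exp n x y : veq x y -> veq (x ^+ n) (y ^+ n).
Proof. by move=> [? ?]; split; apply: vle_exp. Qed.

Lemma veq_sqr_inv x y : veq (x ^+ 2) (y ^+ 2) -> veq x y.
Proof. by move=> [? ?]; split; apply: vle_sqr_inv. Qed.

Lemma veq_neq0 x y : veq x y -> y != 0 -> x != 0.
Proof. by move=> [_ [o _ ->]]; apply: contraNneq => ->; rewrite mulr0. Qed.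

Lemma veq_opp x y : veq x y -> veq (- x) y.
Proof.
move=> [xy yx]; split; first exact: vle_opp.
by case: yx => o Oo ->; exists (- o); [apply: sub_setN|ring].
Qed.

Lemma veq_div1 x y : y != 0 -> veq x y -> veq (x / y) 1.
Proof.
move=> y0 [[o Oo e] [u Ou e']]; split; [exists o|exists u] => //.
  by rewrite e mulfK // mulr1.
by apply: (mulIf y0); rewrite mul1r {1}e' -mulrA divfK.
Qed.

Lemma veq_add x y : vlt x y -> veq (x + y) y.
Proof.
move=> xy; split; first by apply: vle_add (vltW xy) (vle_refl y).
have e : y = (x + y) - x by ring.
have [h|h] := vle_total (x + y) x.
  by case: xy; rewrite {1}e; apply: vle_add h (vle_opp (vle_refl x)).
by rewrite {1}e; apply: vle_add (vle_refl _) (vle_opp h).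
Qed.

Lemma veq_unit_factor x y z w : veq y 1 -> veq z 1 -> veq w 1 -> x != 0 ->
  vlt (2%:R * x * y * z / w) x.
Proof.
move=> ey ez ew x0; have w0 := veq_neq0 ew (oner_neq0 K).
have [le _] : veq (y * z / w) 1.
  apply: veq_div1 => //; apply: veq_trans (veq_sym ew); rewrite -[1]mulr1; exact: veq_mul.
have -> : 2%:R * x * y * z / w = 2%:R * (x * (y * z / w)) by field.
rewrite -[X in vlt _ X]mul1r; apply: vlt_le_mul x0; first exact: vlt21.
by rewrite -[X in vle _ X]mulr1; apply: vle_mul (vle_refl _) le.
Qed.

Lemma veq1D x : vlt x 1 -> veq (1 + x) 1.
Proof. by rewrite addrC; apply: veq_add. Qed.

Lemma vlt1X n x : vlt x 1 -> vlt (x ^+ n.+1) 1.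
Proof.
move=> x1; elim: n => [|n IH] //; rewrite exprS -[1]mulr1.
by apply: vlt_le_mul (oner_neq0 K) => //; apply: vltW.
Qed.

Lemma vlt_opp x y : vlt x y -> vlt (- x) y.
Proof. by move=> xy; apply: vle_lt_trans xy; apply: vle_opp; apply: vle_refl. Qed.

(** Here b, c and 1 + a^4 are units, so the factor 2 alone makes the quotient smaller than a. *)
Lemma vltD_small (a b c : K) : vlt a 1 -> a != 0 -> b ^+ 2 = 1 + a ^+ 2 -> c ^+ 2 = 1 - a ^+ 2 ->
  1 + a ^+ 4 != 0 /\ vlt (2%:R * a * b * c / (1 + a ^+ 4)) a.
Proof.
move=> a1 a0 eb ec; have ew := veq1D (@vlt1X 3 _ a1).
split; first exact: veq_neq0 ew (oner_neq0 K).
apply: veq_unit_factor => //; apply: veq_sqr_inv; rewrite expr1n.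
  by rewrite eb; apply/veq1D/(@vlt1X 1 _).
by rewrite ec; apply/veq1D/vlt_opp/(@vlt1X 1 _).
Qed.

(** Dividing numerator and denominator by a^4 reduces to the small case for 1/a, b/a and c/a, up to
    the sign of (c/a)^2. *)
Lemma vltD_large (a b c : K) : vlt 1 a -> b ^+ 2 = 1 + a ^+ 2 -> c ^+ 2 = 1 - a ^+ 2 ->
  1 + a ^+ 4 != 0 /\ vlt (2%:R * a * b * c / (1 + a ^+ 4)) 1.
Proof.
move=> a1 eb ec; have a0 := vlt_neq0 a1.
have ia1 : vlt a^-1 1.
  move=> [o Oo e]; case: a1; exists o => //.
  by rewrite mulr1 -[LHS]mul1r e divfK.
have ew := veq1D (@vlt1X 3 _ ia1); have w0 := veq_neq0 ew (oner_neq0 K).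
have wE : 1 + a ^+ 4 = a ^+ 4 * (1 + a^-1 ^+ 4) by field.
split; first by rewrite wE mulf_neq0 ?expf_neq0.
have -> : 2%:R * a * b * c / (1 + a ^+ 4) =
    2%:R * a^-1 * (b / a) * (c / a) / (1 + a^-1 ^+ 4).
  by rewrite wE; move: (1 + _) w0 => w w0; field; apply/andP.
apply: vlt_trans (ia1); apply: veq_unit_factor => //; last exact: invr_neq0.
  apply: veq_sqr_inv; rewrite expr1n expr_div_n eb.
  have -> : (1 + a ^+ 2) / a ^+ 2 = 1 + a^-1 ^+ 2 by field.
  by apply/veq1D/(@vlt1X 1 _).
apply: veq_sqr_inv; rewrite expr1n expr_div_n ec.
have -> : (1 - a ^+ 2) / a ^+ 2 = - (1 - a^-1 ^+ 2) by field.
by apply/veq_opp/veq1D/vlt_opp/(@vlt1X 1 _).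
Qed.

(** The larger term dominates both sums: |c|^2 = |2| and |2 (1 + a^4)| = |c|^4 = |4|, so the
    quotient has size |b c| < 1. Hypotheses symmetric in b and c allow exchanging them. *)
Lemma vltD_unit_neq (a b c : K) : veq a 1 -> b ^+ 2 + c ^+ 2 = 2%:R ->
  b ^+ 4 + c ^+ 4 = 2%:R * (1 + a ^+ 4) -> vlt (b ^+ 2) (c ^+ 2) ->
  1 + a ^+ 4 != 0 /\ vlt (2%:R * a * b * c / (1 + a ^+ 4)) 1.
Proof.
move=> [a1 _] e2 e4 bc; have c2 : veq (c ^+ 2) 2%:R by rewrite -e2; apply/veq_sym/veq_add.
have w4 : veq (2%:R * (1 + a ^+ 4)) (2%:R ^+ 2).
  apply: (@veq_trans (c ^+ 4)); last by rewrite (exprM c 2 2); apply: veq_exp.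
  by rewrite -e4; apply: veq_add; rewrite (exprM c 2 2) (exprM b 2 2); apply: vlt_sqr.
have w0 : 1 + a ^+ 4 != 0.
  by have := veq_neq0 w4 (expf_neq0 2 K2); rewrite mulf_eq0 negb_or => /andP[].
split=> //.
have [u1 _] : veq (2%:R ^+ 2 / (2%:R * (1 + a ^+ 4))) 1.
  by apply: veq_div1; [rewrite mulf_neq0|apply: veq_sym].
have c1 : vlt c 1.
  by apply: vlt_sqr_inv; rewrite expr1n; apply: vle_lt_trans vlt21; case: c2.
have b1 : vlt b 1.
  by apply: vlt_trans c1; apply: vlt_sqr_inv.
have -> : 2%:R * a * b * c / (1 + a ^+ 4) =
    b * (a * c * (2%:R ^+ 2 / (2%:R * (1 + a ^+ 4)))).
  by field; rewrite w0 K2.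
rewrite -[X in vlt _ X]mulr1; apply: vlt_le_mul (oner_neq0 K) => //.
rewrite -[X in vle _ X]mulr1; apply: vle_mul => //.
by rewrite -[X in vle _ X]mulr1; apply: vle_mul => //; apply: vltW.
Qed.

(* The second alternative means that the ramification index above 2 is at
   least 8. *)
Lemma vltD_unit (a b c : K) : veq a 1 -> a ^+ 4 != 1 ->
  b ^+ 2 = 1 + a ^+ 2 -> c ^+ 2 = 1 - a ^+ 2 ->
  (1 + a ^+ 4 != 0 /\ vlt (2%:R * a * b * c / (1 + a ^+ 4)) 1)
  \/ exists t, veq (t ^+ 8) 2%:R.
Proof.
move=> ea a4 eb ec; have [a1 _] := ea; have v12 := vltW vlt21.
have e2 : b ^+ 2 + c ^+ 2 = 2%:R by rewrite eb ec; ring.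
have e4 : b ^+ 4 + c ^+ 4 = 2%:R * (1 + a ^+ 4).
  by rewrite (exprM b 2 2) (exprM c 2 2) eb ec; ring.
have [cb|bc] := pselect (vle (c ^+ 2) (b ^+ 2)); last first.
  by left; apply: vltD_unit_neq.
have [bc|cb'] := pselect (vle (b ^+ 2) (c ^+ 2)); last first.
  left; have -> : 2%:R * a * b * c = 2%:R * a * c * b by ring.
  by apply: vltD_unit_neq => //; rewrite addrC.
have ebc : veq (b ^+ 2) (c ^+ 2) by [].
(* Now |b| = |c|. The size of 1 + a^4 is the larger of |2| and |b|^4 whenever these differ; only
   |b|^4 = |2| resists. *)
have wE : 1 + a ^+ 4 = - (2%:R * a ^+ 2) + b ^+ 4 by rewrite (exprM b 2 2) eb; ring.
have a2 : veq (- (2%:R * a ^+ 2)) 2%:R.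
  apply: veq_opp; rewrite -[X in veq _ X]mulr1; apply: veq_mul (veq_refl _) _.
  by rewrite -(expr1n K 2); apply: veq_exp.
have b1 : vle (b ^+ 2) 1.
  rewrite eb; apply: vle_add; first exact: vle_refl.
  by rewrite -(expr1n K 2); apply: vle_exp.
have bcb : vle (b * c) (b ^+ 2).
  by rewrite expr2; apply: vle_mul (vle_refl _) _; apply: vle_sqr_inv.
have [b2|b2] := pselect (vle 2%:R (b ^+ 4)); last first.
  left; have ew : veq (1 + a ^+ 4) 2%:R.
    rewrite wE addrC; apply: veq_trans (a2); apply: veq_add.
    by apply: vlt_le_trans b2 _; case: a2.
  have w0 := veq_neq0 ew K2; split=> //.
  have [u1 _] : veq (2%:R / (1 + a ^+ 4)) 1.
    by apply: veq_div1 => //; apply: veq_sym.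
  have b1' : vlt (b ^+ 2) 1.
    apply: vlt_sqr_inv; rewrite expr1n -exprM; exact: vlt_trans b2 vlt21.
  have -> : 2%:R * a * b * c / (1 + a ^+ 4) = (b * c) * (a * (2%:R / (1 + a ^+ 4))).
    by field.
  rewrite -[X in vlt _ X]mulr1; apply: vlt_le_mul (oner_neq0 K) => //.
    exact: vle_lt_trans bcb b1'.
  by rewrite -[X in vle _ X]mulr1; apply: vle_mul.
have [b2'|b2'] := pselect (vle (b ^+ 4) 2%:R); last first.
  left; have ew : veq (1 + a ^+ 4) (b ^+ 4).
    by rewrite wE; apply: veq_add; apply: vle_lt_trans b2'; case: a2.
  have w0 := veq_neq0 ew (vlt_neq0 b2'); split=> //.
  have b20 : b ^+ 2 != 0 by move: (vlt_neq0 b2'); rewrite !expf_eq0.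
  have lt : vlt (2%:R * (a * (b * c))) (1 + a ^+ 4).
    apply: (@vlt_le_trans (b ^+ 2 * b ^+ 2)); last by rewrite -exprD; case: ew.
    apply: vlt_le_mul b20.
      apply: vlt_le_trans b2' _; rewrite -[X in vle _ X]mulr1 (exprM b 2 2) expr2.
      exact: vle_mul (vle_refl _) b1.
    by rewrite -[X in vle _ X]mul1r; apply: vle_mul.
  move=> [o Oo e]; apply: lt; exists o => //.
  have -> : 2%:R * (a * (b * c)) = 2%:R * a * b * c / (1 + a ^+ 4) * (1 + a ^+ 4).
    by field.
  by rewrite mulrA -e mul1r.
right; have c4 : veq (c ^+ 4) 2%:R.
  by apply: (@veq_trans (b ^+ 4)) => //; rewrite (exprM b 2 2) (exprM c 2 2);
    apply: veq_exp; apply: veq_sym.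
(* If |d| and |e| differed, the larger would be |2|, as d + e = 2, and |c|^4 would be at most |2|^4,
   against |c|^4 = |2|. So |d| = |e| = |c|. *)
pose d := 1 - a; pose e := 1 + a.
have de : c ^+ 2 = d * e by rewrite ec /d /e; ring.
have de2 : d + e = 2%:R by rewrite /d /e; ring.
have small x y : x + y = 2%:R -> c ^+ 2 = x * y -> vle y x.
  move=> exy cxy; apply/not_notP => xy; have ey : veq y 2%:R.
    by rewrite -exy; apply/veq_sym/veq_add.
  have c2 : vle (c ^+ 2) (2%:R ^+ 2).
    rewrite cxy expr2; apply: vle_mul; last by case: ey.
    by apply: vle_trans (vltW xy) _; case: ey.
  have : vlt (c ^+ 4) 2%:R; last by apply; case: c4.
  rewrite (exprM c 2 2); apply: (@vle_lt_trans (2%:R ^+ 4)).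
    by rewrite (exprM 2%:R 2 2); apply: vle_exp.
  rewrite exprSr -[X in vlt _ X]mul1r; apply: vlt_le_mul K2.
    exact: (@vlt1X 2 _ vlt21).
  exact: vle_refl.
have dd : veq d e by split; [apply: (small e d); rewrite 1?addrC // mulrC|apply: small].
have c2 : veq (c ^+ 2) (d ^+ 2).
  by rewrite de expr2; apply: veq_mul (veq_refl _) (veq_sym dd).
have d0 : d != 0.
  move: (veq_neq0 c4 K2); rewrite expf_eq0 /=; apply: contraNneq => d0.
  by have /eqP : c ^+ 2 = 0 by [rewrite de d0 mul0r]; rewrite expf_eq0.
have d1 : vle (2%:R * d) 1.
  rewrite -[X in vle _ X]mulr1; apply: vle_mul => //.
  by apply: vle_add; [apply: vle_refl|apply: vle_opp].
have ad : veq (2%:R * (a * d)) (2%:R * d).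
  apply: veq_mul (veq_refl _) _; rewrite -[X in veq _ X]mul1r.
  exact: veq_mul ea (veq_refl _).
have nolt x y : veq (- x + y) (2%:R * d) -> x * y = 2%:R * (a * d) -> vle y x.
  move=> exy pxy; apply/not_notP => xy.
  have ey : veq y (2%:R * d).
    by apply: veq_trans exy; apply/veq_sym/veq_add/vlt_opp.
  have y0 : y != 0 := vlt_neq0 xy.
  have : vlt (x * y) (y * y) by apply: vlt_le_mul (vle_refl _) y0.
  apply; rewrite pxy; apply: (@vle_trans (2%:R * d)); last by case: ad.
  by rewrite -[X in vle _ X]mulr1; apply: vle_mul; case: ey => // ey _;
    apply: vle_trans ey d1.
(* Since z' - z = 2 d, unequal sizes would make the larger |2 d| and the product smaller than |2
   d|^2 <= |2 d|, which is its actual size. So |z|^2 = |2 d| and |z|^8 = |2|^5. *)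
pose z := c - d; pose z' := c + d.
have zz' : z * z' = 2%:R * (a * d).
  transitivity (c ^+ 2 - d ^+ 2); first by rewrite /z /z'; ring.
  by rewrite de /d /e; ring.
have ez : veq z z'.
  split.
    apply: nolt; last by rewrite mulrC.
    have -> : - z' + z = - (2%:R * d) by rewrite /z /z'; ring.
    by apply: veq_opp; apply: veq_refl.
  apply: nolt => //; have -> : - z + z' = 2%:R * d by rewrite /z /z'; ring.
  exact: veq_refl.
have z2 : veq (z ^+ 2) (2%:R * d).
  by apply: veq_trans ad; rewrite -zz' expr2; apply: veq_mul (veq_refl _) ez.
have z8 : veq (z ^+ 8) (2%:R ^+ 5).
  apply: (@veq_trans ((2%:R * d) ^+ 4)); first by rewrite (exprM z 2 4); apply: veq_exp.
  rewrite exprMn (exprSr 2%:R 4); apply: veq_mul (veq_refl _) _.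
  apply: veq_trans c4; rewrite (exprM c 2 2) (exprM d 2 2).
  by apply: veq_exp; apply: veq_sym.
(* The exponents come from 5 * 5 - 8 * 3 = 1. *)
exists (z ^+ 5 / 2%:R ^+ 3).
have -> : (z ^+ 5 / 2%:R ^+ 3) ^+ 8 = (z ^+ 8) ^+ 5 / (2%:R ^+ 5) ^+ 5 * 2%:R.
  rewrite expr_div_n -!exprM [in RHS](exprSr 2%:R 24) invfM mulrA divfK //.
rewrite -[X in veq _ X]mul1r; apply: veq_mul (veq_refl _).
by apply: veq_div1; [rewrite !expf_neq0|apply: veq_exp].
Qed.

End Valuation.

(** * Bounding the ramification by the degree *)

Lemma natr_neq0 (K : fieldExtType rat) (n : nat) : n.+1%:R != 0 :> K.
Proof. by rewrite -(rmorph_nat (in_alg K)) fmorph_eq0 Num.Theory.pnatr_eq0. Qed.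

(** The polynomial is the primitive integer multiple of the minimal polynomial of t; primitivity
    yields an odd coefficient. *)
Lemma exists_primitive_root_poly (K : fieldExtType rat) (t : K) :
  exists r : {poly int}, [/\ (size r <= (\dim {:K}).+1)%N,
    (map_poly intr r).[t] = 0 & exists i, odd `|r`_i|].
Proof.
have [p ep] := polyOver1P (minPolyOver 1 t).
have [q [a a0 eq]] := rat_poly_scale p.
have pt : (map_poly (in_alg K) p).[t] = 0.
  by apply/eqP; rewrite -rootE -ep root_minPoly.
have p0 : p != 0.
  by rewrite -(map_poly_eq0 (in_alg K)) -ep monic_neq0 // monic_minPoly.
have q0 : q != 0 by apply: contraNneq p0 => q0; rewrite eq q0 rmorph0 scaler0.
have a0' : a%:~R^-1 != 0 :> rat by rewrite invr_eq0 intr_eq0.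
have sp : (size p <= (\dim {:K}).+1)%N.
  rewrite -(size_map_poly (in_alg K)) -ep size_minPoly ltnS.
  apply: leq_trans (dimvS (subvf <<1; t>>)).
  by rewrite dim_Fadjoin dimv1 muln1.
have sq : size q = size p.
  by rewrite eq size_scale // size_map_poly_id0 // intr_eq0 lead_coef_eq0.
exists (zprimitive q); split; first by rewrite size_zprimitive sq.
- have mq : map_poly (in_alg K) (map_poly intr q) = map_poly intr q :> {poly K}.
    by rewrite -map_poly_comp; apply: eq_map_poly => x; exact: rmorph_int.
  have : (map_poly intr q).[t] = 0 :> K.
    move: pt; rewrite eq linearZ /= mq hornerZ => /eqP.
    by rewrite mulf_eq0 scaler_eq0 (negPf a0') oner_eq0 => /eqP.
  rewrite {1}[q]zpolyEprim -mul_polyC rmorphM /= hornerM map_polyC hornerC.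
  move/eqP; rewrite mulf_eq0 => /orP[|/eqP //].
  rewrite -[X in X == _]/((zcontents q)%:~R) -(rmorph_int (in_alg K)) fmorph_eq0.
  by rewrite intr_eq0 zcontents_eq0 (negPf q0).
apply: contrapT => no; have : (2 %| zcontents (zprimitive q))%Z.
  rewrite dvdz_contents; apply/polyOverP => i.
  suff : ~~ odd `|(zprimitive q)`_i| by rewrite -dvdn2.
  by apply/negP => oi; apply: no; exists i.
by rewrite zcontents_primitive q0.
Qed.

(** In an integral relation for t of degree at most 7, let i0 be the least index with an odd
    coefficient. Its term has size |t|^i0. Terms below are at most |2| = |t|^8 <= |t|^(i0+1), and
    terms above are at most |t|^(i0+1), so the sum cannot vanish. *)
Lemma no_eighth_root2 (K : fieldExtType rat) (O : set K) (t : K) :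
  (\dim {:K} <= 7)%N -> valuation_ring_over2 O -> ~ veq O (t ^+ 8) 2%:R.
Proof.
move=> dimK VO t8; have [sO _ _] := VO; have K0 := natr_neq0 K.
have lt21 := vlt21 K0 VO.
have nt1 : ~ vle O 1 t.
  move=> t1; have : vlt O (t ^+ 8) 1 by apply: vle_lt_trans lt21 => //; case: t8.
  by apply; have := vle_exp VO 8 t1; rewrite expr1n.
have t1 : vle O t 1 by case: (vle_total VO t 1) => // /nt1.
have [r [sr rt oi]] := exists_primitive_root_poly t.
have [i0 oi0 min] := ex_minnP oi.
have le2 n : (n <= 8)%N -> vle O 2%:R (t ^+ n).
  move=> n8; apply: (vle_trans VO) (proj2 t8) _.
  rewrite -(subnK n8) exprD -[X in vle _ _ X]mul1r; apply: (vle_mul VO) (vle_refl VO _).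
  by have := vle_exp VO (8 - n) t1; rewrite expr1n.
have ti n m : (n <= m)%N -> vle O (t ^+ m) (t ^+ n).
  move=> nm; rewrite -(subnK nm) exprD -[X in vle _ _ X]mul1r.
  apply: (vle_mul VO) (vle_refl VO _).
  by have := vle_exp VO (m - n) t1; rewrite expr1n.
have i0s : (i0 < size r)%N.
  rewrite ltnNge; apply/negP => h; by move: oi0; rewrite nth_default.
have i08 : (i0 < 8)%N by apply: leq_trans i0s (leq_trans sr _).
pose S := \sum_(i < size r | i != Ordinal i0s) (r`_i)%:~R * t ^+ i.
have even_small (n : int) : ~~ odd `|n| -> vle O (n%:~R) 2%:R.
  move=> en; have /dvdzP [m ->] : (2 %| n)%Z by move: en; rewrite -dvdn2.
  rewrite rmorphM /= -[X in vle _ _ X]mul1r; apply: (vle_mul VO) (vle_refl VO _).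
  exact: vle_int1.
have leS : vle O S (t ^+ i0.+1).
  apply: (big_ind (fun x => vle O x _)) => [|x y|i ne].
  - exact: vle0.
  - exact: vle_add.
  have [lt|ge] := ltnP i i0.
    apply: (vle_trans VO) (le2 i0.+1 i08); rewrite -[X in vle _ _ X]mulr1.
    apply: (vle_mul VO).
      apply: even_small; apply/negP => /min; by rewrite leqNgt lt.
    by have := vle_exp VO i t1; rewrite expr1n.
  rewrite -[X in vle _ _ X]mul1r; apply: (vle_mul VO); first exact: vle_int1.
  by apply: ti; rewrite ltn_neqAle ge eq_sym andbT.
have eS : (r`_i0)%:~R * t ^+ i0 = - S.
  move: rt; rewrite (horner_coef_wide t (n := size r)); last first.
    by rewrite size_poly.
  rewrite (bigD1 (Ordinal i0s)) //= coef_map => /eqP; rewrite addr_eq0 => /eqP ->.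
  by congr (- _); apply: eq_bigr => i _; rewrite coef_map.
have [_ u1] : veq O (r`_i0)%:~R 1.
  have -> : (r`_i0)%:~R = - (1 - (r`_i0)%:~R) + 1 :> K by ring.
  apply: veq_add => //; apply: (vle_lt_trans VO) lt21; apply: vle_opp => //.
  have -> : 1 - (r`_i0)%:~R = (1 - r`_i0)%:~R :> K by rewrite rmorphB.
  apply: even_small; case: (r`_i0) oi0 => [[|k]|k] //=.
    by rewrite -[k.+1]add1n PoszD opprD addNKr abszN.
  by rewrite negbK.
have t0 : t != 0.
  by have := veq_neq0 t8 (K0 1%N); rewrite expf_eq0.
apply: nt1; apply: (@vle_pmul2r _ _ (t ^+ i0)); first exact: expf_neq0.
apply: (vle_trans VO) (_ : vle O _ ((r`_i0)%:~R * t ^+ i0)) _.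
  by apply: (vle_mul VO) u1 (vle_refl VO _).
by rewrite eS -exprS; apply: vle_opp.
Qed.

(** * Points of the modular curve *)

Section ModularCurve.

Variable K : fieldType.

(* The affine genus-one curve [b^2 = 1 + a^2], [c^2 = 1 - a^2]: its points with
   [a != 0] and [a^4 != 1] are the noncuspidal points of X_1(4,8). *)
Definition noncusp (p : K * K * K) :=
  let: (a, b, c) := p in
  [/\ a != 0, a ^+ 4 != 1, b ^+ 2 = 1 + a ^+ 2 & c ^+ 2 = 1 - a ^+ 2].

(** Jacobi's duplication formulas for k^2 = -1 with a = sn, b = dn, c = cn. The last two carry a
    common minus sign, which amounts to taking (0, -1, -1) as origin. *)
Definition double (p : K * K * K) : K * K * K :=
  let: (a, b, c) := p in
  (2%:R * a * b * c / (1 + a ^+ 4),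
   (a ^+ 4 - 2%:R * a ^+ 2 - 1) / (1 + a ^+ 4),
   (a ^+ 4 + 2%:R * a ^+ 2 - 1) / (1 + a ^+ 4)).

Variable O : set K.
Hypotheses (K0 : forall n : nat, n.+1%:R != 0 :> K) (VO : valuation_ring_over2 O).

(** The bound |a'| < 1 excludes a'^4 = 1; the condition a' != 0 comes from 2, a, b, c being
    nonzero. *)
Lemma noncusp_double a b c : noncusp (a, b, c) -> 1 + a ^+ 4 != 0 ->
  vlt O (2%:R * a * b * c / (1 + a ^+ 4)) 1 -> noncusp (double (a, b, c)).
Proof.
move=> [a0 a4 eb ec] w0 lt.
have bc : b ^+ 2 * c ^+ 2 = 1 - a ^+ 4 by rewrite eb ec; ring.
have bc0 : b ^+ 2 * c ^+ 2 != 0 by rewrite bc subr_eq0 eq_sym.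
have b0 : b != 0 by apply: contraNneq bc0 => ->; rewrite expr0n mul0r.
have c0 : c != 0 by apply: contraNneq bc0 => ->; rewrite expr0n mulr0.
have sq : (2%:R * a * b * c / (1 + a ^+ 4)) ^+ 2
    = 4%:R * a ^+ 2 * (1 - a ^+ 4) / (1 + a ^+ 4) ^+ 2.
  by rewrite -bc; field.
split; rewrite ?sq; try by field.
  by rewrite !mulf_neq0 ?invr_neq0 //; apply: K0 1%N.
apply/eqP => e; have := @vlt1X _ _ VO 3 _ lt; rewrite e; apply; exact: vle_refl.
Qed.

Lemma noncusp_orbit (p : K * K * K) : (forall t, ~ veq O (t ^+ 8) 2%:R) ->
  noncusp p -> exists q : nat -> K * K * K,
    forall n, [/\ noncusp (q n), vlt O (q n).1.1 1 & vlt O (q n.+1).1.1 (q n).1.1].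
Proof.
move=> no8 np.
have small r : noncusp r -> vlt O r.1.1 1 ->
    noncusp (double r) /\ vlt O (double r).1.1 r.1.1.
  case: r => [[a b] c] nr lt; have [a0 _ eb ec] := nr.
  have [w0 lt'] := vltD_small K0 VO lt a0 eb ec; split=> //.
  by apply: noncusp_double => //; apply: (vlt_trans VO) lt' lt.
have [q0 nq0 lq0] : exists2 q0, noncusp q0 & vlt O q0.1.1 1.
  have [lt|nlt] := pselect (vlt O p.1.1 1); first by exists p.
  case: p np nlt => [[a b] c] np nlt; have [a0 a4 eb ec] := np.
  suff [w0 lt] : 1 + a ^+ 4 != 0 /\ vlt O (2%:R * a * b * c / (1 + a ^+ 4)) 1.
    by exists (double (a, b, c)) => //; apply: noncusp_double.
  have [a1|na1] := pselect (vle O a 1); last exact: vltD_large.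
  have ea : veq O a 1 by split=> //; apply/not_notP.
  by have [//|[t /no8]] := vltD_unit K0 VO ea a4 eb ec.
exists (fun n => iter n double q0) => n.
suff [nq lq] : noncusp (iter n double q0) /\ vlt O (iter n double q0).1.1 1.
  by have [_] := small _ nq lq.
elim: n => // n [nq lq]; have [nq' lq'] := small _ nq lq.
by split=> //; apply: (vlt_trans VO) lq' lq.
Qed.

End ModularCurve.

(** * Square roots obtained from halved points *)

Section Halving.

Variables (F : fieldType) (a1 a2 a3 a4 a6 : F).
Hypothesis F2 : 2%:R != 0 :> F.

Let W := Weierstrass a1 a2 a3 a4 a6.
Let b2 := a1 ^+ 2 + 4%:R * a2.
Let b4 := 2%:R * a4 + a1 * a3.
Let b6 := a3 ^+ 2 + 4%:R * a6.
Let Y x y := 2%:R * y + a1 * x + a3.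

(** Coefficients of 4 x^3 + b2 x^2 + 2 b4 x + b6 = 4 (x - e1) (x - e2) (x - e3). *)
Definition two_division_roots e1 e2 e3 :=
  [/\ b2 = - (4%:R * (e1 + e2 + e3)), b4 = 2%:R * (e1 * e2 + e1 * e3 + e2 * e3)
    & b6 = - (4%:R * (e1 * e2 * e3))].

Lemma sqr_Y x y : oncurve W (Some (x, y)) ->
  Y x y ^+ 2 = 4%:R * x ^+ 3 + b2 * x ^+ 2 + 2%:R * b4 * x + b6.
Proof.
move=> /eqP /= e; transitivity (4%:R * (y ^+ 2 + a1 * x * y + a3 * y)
  + (a1 * x + a3) ^+ 2); first by rewrite /Y; ring.
by rewrite e /b2 /b4 /b6; ring.
Qed.

Lemma wadd_double_eq0 x y :
  wadd W (Some (x, y)) (Some (x, y)) = None -> Y x y = 0.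
Proof.
by rewrite /= eqxx /=; case: eqP => // e _; rewrite -e /Y; ring.
Qed.

(** The explicit form of the 2-descent fact that x(2P) - e1 is a square: every halving relation
    yields square roots in F. *)
Lemma wadd_double_sub x y r s e1 e2 e3 :
  oncurve W (Some (x, y)) -> two_division_roots e1 e2 e3 ->
  wadd W (Some (x, y)) (Some (x, y)) = Some (r, s) ->
  Y x y != 0 /\
  r - e1 = (((x - e1) ^+ 2 - (e1 - e2) * (e1 - e3)) / Y x y) ^+ 2.
Proof.
move=> /sqr_Y eY [eb2 eb4 eb6]; rewrite /= eqxx /=.
have -> : y + y + a1 * x + a3 = Y x y by rewrite /Y; ring.
case: eqP => // /eqP Y0 [er _]; split=> //.
have F4 : 4%:R != 0 :> F by rewrite (natrM _ 2 2) mulf_neq0.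
apply: (mulfI F4); rewrite -er -/(Y x y).
(* The fraction is 2 l + a1, where l is the slope of the tangent. *)
transitivity (((6%:R * x ^+ 2 + b2 * x + b4) / Y x y) ^+ 2
              - b2 - 8%:R * x - 4%:R * e1).
  by rewrite /b2 /b4; move: Y0; rewrite /Y => Y0; field.
apply: (mulIf (expf_neq0 2 Y0)).
transitivity ((6%:R * x ^+ 2 + b2 * x + b4) ^+ 2
  - (b2 + 8%:R * x + 4%:R * e1) * Y x y ^+ 2); first by move: (Y x y) Y0 => z z0; field.
transitivity (4%:R * ((x - e1) ^+ 2 - (e1 - e2) * (e1 - e3)) ^+ 2).
  by rewrite eY eb2 eb4 eb6; ring.
by move: (Y x y) Y0 => z z0; field.
Qed.

Lemma two_division_rootsP e1 e2 e3 y1 y2 y3 :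
  e1 != e2 -> e1 != e3 -> e2 != e3 ->
  oncurve W (Some (e1, y1)) -> oncurve W (Some (e2, y2)) ->
  oncurve W (Some (e3, y3)) ->
  Y e1 y1 = 0 -> Y e2 y2 = 0 -> Y e3 y3 = 0 -> two_division_roots e1 e2 e3.
Proof.
rewrite -subr_eq0 -[e1 == e3]subr_eq0 -[e2 == e3]subr_eq0 => n12 n13 n23.
move=> /sqr_Y + /sqr_Y + /sqr_Y + h1 h2 h3; rewrite h1 h2 h3 expr2 mul0r => g1 g2 g3.
have d12 : 4%:R * (e1 ^+ 2 + e1 * e2 + e2 ^+ 2) + b2 * (e1 + e2) + 2%:R * b4 = 0.
  by apply: (mulfI n12); rewrite mulr0 -[RHS](subrr 0) {1}g1 g2; ring.
have d13 : 4%:R * (e1 ^+ 2 + e1 * e3 + e3 ^+ 2) + b2 * (e1 + e3) + 2%:R * b4 = 0.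
  by apply: (mulfI n13); rewrite mulr0 -[RHS](subrr 0) {1}g1 g3; ring.
have eb2 : b2 = - (4%:R * (e1 + e2 + e3)).
  apply/eqP; rewrite -addr_eq0; apply/eqP.
  by apply: (mulfI n23); rewrite mulr0 -[RHS](subrr 0) -{1}d12 -d13; ring.
have eb4 : b4 = 2%:R * (e1 * e2 + e1 * e3 + e2 * e3).
  apply: (mulfI F2); apply/eqP; rewrite -subr_eq0; apply/eqP.
  by rewrite -[RHS]d12 eb2; ring.
split=> //; apply/eqP; rewrite -subr_eq0; apply/eqP.
by rewrite [RHS]g1 eb2 eb4; ring.
Qed.

End Halving.

Lemma embed_noncusp (F : fieldType) (E : ellcurve F) : 2%:R != 0 :> F ->
  embeds_in_points ('Z_4 * 'Z_8)%type E ->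
  (exists p : F * F * F, noncusp p) /\ exists i : F, i ^+ 2 = -1.
Proof.
move=> F2 [f [finj fD]]; case: E f finj fD => [[a1 a2 a3 a4 a6] dE] /= f finj fD.
set W := Weierstrass a1 a2 a3 a4 a6.
pose pt g := sval (f g).
have ptI g h : pt g = pt h -> g = h by move=> /eq_sig_hprop e; apply/finj/e => ? ? ?; apply: bool_irrelevance.
have ptD g h : pt (g + h) = wadd W (pt g) (pt h) by rewrite /pt fD.
have pto g : oncurve W (pt g) := svalP (f g).
have pt0 : pt 0 = None.
  have := ptD 0 0; rewrite addr0; case: (pt 0) => [[x y]|] //=.
  rewrite eqxx /=; case: ifP => // /negP n0 [e1]; rewrite -e1 => e2; case: n0.
  by rewrite {1}e2; apply/eqP; ring.
have nz g : g != 0 -> exists x y, pt g = Some (x, y).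
  move=> g0; case E : (pt g) => [[x y]|]; first by exists x, y.
  by case/eqP: g0; apply: ptI; rewrite pt0.
have dbl g h : h + h = g -> pt g = wadd W (pt h) (pt h) by move=> <-.
pose t1 : 'Z_4 * 'Z_8 := (0, 4%:R); pose t2 : 'Z_4 * 'Z_8 := (2%:R, 0).
pose t3 : 'Z_4 * 'Z_8 := (2%:R, 4%:R).
have [e1 [y1 T1]] : exists x y, pt t1 = Some (x, y) by apply: nz.
have [e2 [y2 T2]] : exists x y, pt t2 = Some (x, y) by apply: nz.
have [e3 [y3 T3]] : exists x y, pt t3 = Some (x, y) by apply: nz.
have [x4 [y4 Q4]] : exists x y, pt (0, 2%:R) = Some (x, y) by apply: nz.
have [x8 [y8 Q8]] : exists x y, pt (0, 1) = Some (x, y) by apply: nz.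
have [x5 [y5 Q5]] : exists x y, pt (1, 0) = Some (x, y) by apply: nz.
have [x6 [y6 Q6]] : exists x y, pt (1, 2%:R) = Some (x, y) by apply: nz.
have on g x y : pt g = Some (x, y) -> oncurve W (Some (x, y)) by move=> <-.
have tor t x y : t + t = 0 -> pt t = Some (x, y) -> 2%:R * y + a1 * x + a3 = 0.
  by move=> /dbl; rewrite pt0 => /esym h e; apply: (@wadd_double_eq0 _ _ a2 _ a4 a6); rewrite -/W -e.
have z1 : 2%:R * y1 + a1 * e1 + a3 = 0 by apply: tor T1; apply/eqP.
have z2 : 2%:R * y2 + a1 * e2 + a3 = 0 by apply: tor T2; apply/eqP.
have z3 : 2%:R * y3 + a1 * e3 + a3 = 0 by apply: tor T3; apply/eqP.
have dist t t' x y x' y' : t != t' -> pt t = Some (x, y) -> pt t' = Some (x', y') ->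
    2%:R * y + a1 * x + a3 = 0 -> 2%:R * y' + a1 * x' + a3 = 0 -> x != x'.
  move=> tt' e e' z z'; apply: contra_neq tt' => exx; subst x'.
  apply: ptI; rewrite e e'; congr (Some (_, _)); apply: (mulfI F2).
  have {}z : 2%:R * y = - (a1 * x + a3) by apply/eqP; rewrite -addr_eq0 addrA z.
  by rewrite z; apply/eqP; rewrite eq_sym -addr_eq0 addrA z'.
have n12 : e1 != e2 by apply: dist T1 T2 z1 z2.
have n13 : e1 != e3 by apply: dist T1 T3 z1 z3.
have n23 : e2 != e3 by apply: dist T2 T3 z2 z3.
have R := two_division_rootsP F2 n12 n13 n23 (on _ _ _ T1) (on _ _ _ T2) (on _ _ _ T3) z1 z2 z3.
have R2 : two_division_roots a1 a2 a3 a4 a6 e2 e1 e3.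
  by case: R => r1 r2 r3; split; rewrite ?r1 ?r2 ?r3; ring.
have half g h x y r s d1 d2 d3 : h + h == g -> pt h = Some (x, y) -> pt g = Some (r, s) ->
    two_division_roots a1 a2 a3 a4 a6 d1 d2 d3 ->
    2%:R * y + a1 * x + a3 != 0 /\ r - d1 =
      (((x - d1) ^+ 2 - (d1 - d2) * (d1 - d3)) / (2%:R * y + a1 * x + a3)) ^+ 2.
  move=> /eqP /dbl hg eh eg Rd; apply: wadd_double_sub (on _ _ _ eh) Rd _ => //.
  by rewrite -/W -eh -hg; exact: eg.
(* The relations give (x4 - e1)^2 = (e1 - e2) (e1 - e3), then e1 - e2 = s^2, e2 - e1 = u^2, e3 - e2
   = w^2, x4 - e1 = k^2 and x4 - e2 = m^2. *)
have [Y4 h1] := @half t1 (0, 2%:R) _ _ _ _ _ _ _ isT Q4 T1 R.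
have [_] := @half t1 (0, 2%:R) _ _ _ _ _ _ _ isT Q4 T1 R2.
set s := (_ / _ : F) => hs.
have [_] := @half t2 (1, 0) _ _ _ _ _ _ _ isT Q5 T2 R.
set u := (_ / _ : F) => hu.
have [_] := @half t3 (1, 2%:R) _ _ _ _ _ _ _ isT Q6 T3 R2.
set w := (_ / _ : F) => hw.
have [_] := @half (0, 2%:R) (0, 1) _ _ _ _ _ _ _ isT Q8 Q4 R.
set k := (_ / _ : F) => hk.
have [_] := @half (0, 2%:R) (0, 1) _ _ _ _ _ _ _ isT Q8 Q4 R2.
set m := (_ / _ : F) => hm.
have e4 : (x4 - e1) ^+ 2 = (e1 - e2) * (e1 - e3).
  apply/eqP; rewrite -subr_eq0; move/esym/eqP: h1; rewrite subrr.
  by rewrite expf_eq0 /= mulf_eq0 invr_eq0 (negPf Y4) orbF.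
have d12 : e1 - e2 != 0 by rewrite subr_eq0.
have d13 : e1 - e3 != 0 by rewrite subr_eq0.
have d23 : e3 - e2 != 0 by rewrite subr_eq0 eq_sym.
have s0 : s != 0 by apply: contraNneq d12; rewrite hs => ->; rewrite expr0n.
have a2E : (k / s) ^+ 2 = (x4 - e1) / (e1 - e2) by rewrite hk hs expr_div_n.
have a4E : (k / s) ^+ 4 = (e1 - e3) / (e1 - e2).
  by rewrite (exprM _ 2 2) a2E expr_div_n e4; field.
have b2E : (m / s) ^+ 2 = 1 + (k / s) ^+ 2.
  by rewrite a2E expr_div_n -hm -hs; field.
have a40 : (k / s) ^+ 4 != 1.
  apply: contraNneq d23 => e; rewrite -(mulrI_eq0 _ (mulfI (invr_neq0 d12))).
  by apply/eqP; transitivity (1 - (e1 - e3) / (e1 - e2)); [field|rewrite -a4E e subrr].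
have bc : (w / s) ^+ 2 = 1 - (k / s) ^+ 4.
  by rewrite a4E expr_div_n -hw -hs; field.
have m0 : m / s != 0.
  apply: contraNneq a40 => e; move: b2E; rewrite e expr0n /= => /esym/eqP.
  by rewrite addrC addr_eq0 => /eqP e'; rewrite (exprM _ 2 2) e' sqrrN expr1n.
split; last by exists (u / s); rewrite expr_div_n -hu -hs; field.
(* (w / s)^2 is 1 - a^4 and (m / s)^2 is 1 + a^2, so their quotient is 1 - a^2. *)
exists (k / s, m / s, w / s / (m / s)); split=> //.
  have : (k / s) ^+ 4 != 0 by rewrite a4E mulf_neq0 ?invr_neq0.
  by rewrite expf_eq0.
have -> : 1 - (k / s) ^+ 2 = (1 - (k / s) ^+ 4) / (m / s) ^+ 2.
  have -> : 1 - (k / s) ^+ 4 = (1 - (k / s) ^+ 2) * (m / s) ^+ 2.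
    by rewrite b2E; ring.
  by rewrite mulfK // expf_neq0.
by rewrite [LHS]expr_div_n bc.
Qed.

(** * Curves with a given modular point *)

Section HalvedPoint.

Variables (F : fieldType) (x r1 r2 r3 A B C : F).
Hypothesis F2 : 2%:R != 0 :> F.

Let e1 := x - r1 ^+ 2.
Let e2 := x - r2 ^+ 2.
Let e3 := x - r3 ^+ 2.

Hypotheses (eA : A = - (e1 + e2 + e3)) (eB : B = e1 * e2 + e1 * e3 + e2 * e3)
  (eC : C = - (e1 * e2 * e3)).

Let W := Weierstrass 0 A 0 B C.

(** The classical halving formula: square roots r1, r2, r3 of the differences x - e_i determine one
    half of (x, r1 r2 r3). *)
Definition halved : option (F * F) :=
  Some (x + r1 * r2 + r1 * r3 + r2 * r3, (r1 + r2) * (r1 + r3) * (r2 + r3)).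

Lemma oncurve_halved : oncurve W halved.
Proof. by rewrite oncurveE eA eB eC /e1 /e2 /e3; apply/eqP; ring. Qed.

(* The tangent at the halved point has slope [r1 + r2 + r3]. *)
Lemma wadd_halved : (r1 + r2) * (r1 + r3) * (r2 + r3) != 0 ->
  wadd W halved halved = Some (x, r1 * r2 * r3).
Proof.
move=> y0; pose l := r1 + r2 + r3; pose n := - (l * x + r1 * r2 * r3).
pose x0 := x + r1 * r2 + r1 * r3 + r2 * r3.
have L : on_line A B C l n x0 x0 x.
  by split; rewrite ?eA ?eB ?eC /e1 /e2 /e3 /n /x0 /l; ring.
have ey : l * x0 + n = (r1 + r2) * (r1 + r3) * (r2 + r3) by rewrite /n /x0 /l; ring.
have := add_on_line L; rewrite ey eqxx /= -/W => -> //.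
  by rewrite /n; congr (Some (_, _)); ring.
by rewrite -mulr2n -mulr_natl mulf_neq0.
Qed.

End HalvedPoint.

(** * The curves y^2 = x (x + 1) (x + a^4): torsion and j-invariant *)

Definition legendre (F : fieldType) (a : F) : weierstrass F :=
  Weierstrass 0 (1 + a ^+ 4) 0 (a ^+ 4) 0.

Lemma disc_legendre (F : fieldType) (a : F) :
  disc (legendre a) = 16%:R * (a ^+ 8 * (1 - a ^+ 4) ^+ 2).
Proof. by rewrite /disc /legendre; ring. Qed.

Lemma nonsingular_legendre (F : fieldType) (l : F) :
  l != 0 -> l != 1 -> nonsingular (1 + l) l 0.
Proof.
move=> l0 l1 x e; have : x * (x + 1) * (x + l) = 0 by rewrite -[RHS]e; ring.
have d : 1 - l != 0 by rewrite subr_eq0 eq_sym.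
move/eqP; rewrite !mulf_eq0 -orbA => /or3P[/eqP->||].
- by move: l0; congr (_ != 0); ring.
- by rewrite addr_eq0 => /eqP ->; move: d; congr (_ != 0); ring.
- rewrite addr_eq0 => /eqP ->; move: (mulf_neq0 l0 d); rewrite -oppr_eq0.
  by congr (_ != 0); ring.
Qed.

Lemma embeds_legendre (F : fieldType) (L : closedFieldType)
    (iota : {rmorphism F -> L}) (a b c i : F) :
  2%:R != 0 :> F -> noncusp (a, b, c) -> i ^+ 2 = -1 ->
  exists2 E : ellcurve F, embeds_in_points ('Z_4 * 'Z_8)%type E &
    ec_weierstrass E = legendre a.
Proof.
move=> F2 [a0 a4 eb ec] ei.
have L2 : 2%:R != 0 :> L by rewrite -(rmorph_nat iota) fmorph_eq0.
have l0 : a ^+ 4 != 0 by rewrite expf_neq0.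
have d : disc (legendre a) != 0.
  rewrite disc_legendre (_ : 16%:R = 2%:R ^+ 4); last by rewrite -natrX.
  by rewrite !mulf_neq0 ?expf_neq0 // subr_eq0 eq_sym.
pose E := EllCurve d; exists E => //.
have ns : nonsingular (1 + a ^+ 4) (a ^+ 4) 0 by apply: nonsingular_legendre.
have nsL : nonsingular (iota (1 + a ^+ 4)) (iota (a ^+ 4)) (iota 0).
  rewrite rmorphD rmorph1 rmorph0; apply: nonsingular_legendre.
    by rewrite fmorph_eq0.
  by rewrite fmorph_eq1.
have ptI (P Q : ecpoint E) : sval P = sval Q -> P = Q.
  by move=> /eq_sig_hprop; apply => ? ? ?; apply: bool_irrelevance.
pose O : ecpoint E := exist _ None isT.
have opA : associative (@ecadd F E).
  by move=> P Q R; apply/ptI/esym; exact: (waddA_descent L2 nsL (svalP P) (svalP Q) (svalP R)).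
have opC : commutative (@ecadd F E).
  by move=> P Q; apply: ptI; exact: (waddC F2 (svalP P) (svalP Q)).
have op0 : left_id O (@ecadd F E) by move=> P; apply/ptI.
have bc : (b * c) ^+ 2 = 1 - a ^+ 4 by rewrite exprMn eb ec; ring.
have bc0 : b * c != 0.
  by have : (b * c) ^+ 2 != 0; [rewrite bc subr_eq0 eq_sym|rewrite expf_eq0].
have b0 : b != 0 by apply: contraNneq bc0 => ->; rewrite mul0r.
have a2 : a ^+ 2 != 1 by apply: contraNneq a4 => e; rewrite (exprM a 2 2) e expr1n.
have half_ok x r1 r2 r3 :
    1 + a ^+ 4 = - (x - r1 ^+ 2 + (x - r2 ^+ 2) + (x - r3 ^+ 2)) ->
    a ^+ 4 = (x - r1 ^+ 2) * (x - r2 ^+ 2) + (x - r1 ^+ 2) * (x - r3 ^+ 2)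
             + (x - r2 ^+ 2) * (x - r3 ^+ 2) ->
    0 = - ((x - r1 ^+ 2) * (x - r2 ^+ 2) * (x - r3 ^+ 2)) ->
    [/\ r1 + r2 != 0, r1 + r3 != 0 & r2 + r3 != 0] ->
    exists2 P : ecpoint E, sval P = halved x r1 r2 r3
      & sval (ecadd P P) = Some (x, r1 * r2 * r3).
  move=> eA eB eC [n12 n13 n23].
  exists (exist _ (halved x r1 r2 r3) (oncurve_halved eA eB eC)) => //.
  by apply: (wadd_halved F2 eA eB eC); rewrite !mulf_neq0.
have ab0 : a + b != 0.
  apply: contra_eq_neq eb; rewrite addrC => /eqP; rewrite addr_eq0 => /eqP ->.
  by rewrite sqrrN eq_sym -subr_eq0 addrK oner_eq0.
have a10 : 1 + a != 0.
  by apply: contraNneq a2 => /eqP; rewrite addrC addr_eq0 => /eqP ->; rewrite sqrrN expr1n.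
have b10 : 1 + b != 0.
  apply: contraNneq a0 => /eqP; rewrite addrC addr_eq0 => /eqP e; move: eb.
  rewrite e sqrrN expr1n => /esym/eqP; rewrite addrC -subr_eq0 addrK.
  by rewrite expf_eq0.
have bc10 : 1 + b * c != 0.
  apply: contraNneq l0 => /eqP; rewrite addrC addr_eq0 => /eqP e; move: bc.
  by rewrite e sqrrN expr1n => /eqP; rewrite eq_sym subr_eq addrC -subr_eq subrr eq_sym.
have i0 : i != 0.
  by apply/eqP => e; move/eqP: ei; rewrite e expr0n eq_sym oppr_eq0 oner_eq0.
(* With roots 0, -1, -a^4, the abscissa a^2 has differences a^2, 1 + a^2 = b^2 and a^2 + a^4 = (a
   b)^2, so the point is halvable. *)
have [P _ PP] : exists2 P : ecpoint E, True &
    sval (ecadd P P) = Some (a ^+ 2, a * b * (a * b)).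
  have [||||P _ PP] := half_ok (a ^+ 2) a b (a * b); last by exists P.
  - by rewrite exprMn eb; ring.
  - by rewrite exprMn eb; ring.
  - by rewrite subrr !mul0r oppr0.
  - split=> //; first by rewrite -[X in X + _]mulr1 -mulrDr mulf_neq0.
    by rewrite -[X in X + _]mul1r -mulrDl mulf_neq0.
(* The differences are -1 = i^2, 0 and a^4 - 1 = (i b c)^2: this is where the square root of -1 is
   used. *)
have [Q _ QQ] : exists2 Q : ecpoint E, True & sval (ecadd Q Q) = Some (-1, 0).
  have [||||Q _ QQ] := half_ok (-1) i 0 (i * (b * c)).
  - by rewrite exprMn ei bc; ring.
  - by rewrite exprMn ei bc; ring.
  - by rewrite ei opprK addrC subrr !mul0r oppr0.
  - rewrite add0r addr0 i0 mulf_neq0 //; split=> //.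
    by rewrite -[X in X + _]mulr1 -mulrDr mulf_neq0.
  by exists Q => //; rewrite QQ mulr0 mul0r.
(* 2P is itself the half of (0, 0) given by the square roots 0, 1, a^2. *)
have P4 : sval (ecadd (ecadd P P) (ecadd P P)) = Some (0, 0).
  have [||||R eR RR] := half_ok 0 0 1 (a ^+ 2).
  - by ring.
  - by ring.
  - by ring.
  - by rewrite !add0r oner_eq0 -eb !expf_neq0.
  have -> : ecadd P P = R; last by rewrite RR !mul0r.
  apply: ptI; rewrite PP eR /halved; congr (Some (_, _)); first by ring.
  by transitivity (a ^+ 2 * b ^+ 2); [ring|rewrite eb; ring].
have two (R : ecpoint E) x : sval R = Some (x, 0) -> ecadd R R = O.
  by move=> eR; apply: ptI; rewrite /= eR /= eqxx !mul0r !addr0 eqxx.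
have it2 R : iter 2 (ecadd R) O = ecadd R R.
  by rewrite /= [ecadd R O]opC op0.
have it4 R : iter 4 (ecadd R) O = ecadd (ecadd R R) (ecadd R R).
  by rewrite (iter_opD opA op0 R 2 2) it2.
apply: (embed_Z4_Z8 opA opC op0 (P := P) (Q := Q)).
- by rewrite it4; apply: two QQ.
- by rewrite (iter_opD opA op0 P 4 4) it4; apply: two P4.
- by rewrite it2 => /(congr1 sval); rewrite QQ.
- by rewrite it4 => /(congr1 sval); rewrite P4.
rewrite it2 it4 => /(congr1 sval); rewrite QQ P4 => -[/eqP].
by rewrite oppr_eq0 oner_eq0.
Qed.

(** Equality of j-invariants with denominators cleared, where j = 2^8 (1 - v + v^2)^3 / (v^2 (1 -
    v)^2) for v = a^4. *)
Lemma legendre_isom (F L : fieldType) (iota : {rmorphism F -> L}) (a a' : F) :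
  2%:R != 0 :> L ->
  weierstrass_isom (map_weierstrass iota (legendre a))
                   (map_weierstrass iota (legendre a')) ->
  (1 - a' ^+ 4 + a' ^+ 8) ^+ 3 * (a ^+ 8 * (1 - a ^+ 4) ^+ 2)
  = (1 - a ^+ 4 + a ^+ 8) ^+ 3 * (a' ^+ 8 * (1 - a' ^+ 4) ^+ 2).
Proof.
move=> L2 [u [r [s [t [u0 [e1 e2 e3 e4 e6]]]]]]; apply: (fmorph_inj iota).
rewrite !(rmorphM, rmorphXn, rmorphB, rmorphD, rmorph1).
move: e1 e2 e3 e4 e6; rewrite !(rmorph0, rmorphD, rmorph1, rmorphXn) !(mulr0, addr0, subr0, add0r).
move: (iota a) (iota a') => x x'.
move=> /esym/eqP; rewrite mulf_eq0 (negPf L2) => /eqP s0.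
move=> e2 /esym/eqP; rewrite mulf_eq0 (negPf L2) => /eqP t0.
move: e2; rewrite {}s0 {}t0 !(mul0r, mulr0, addr0, subr0, expr0n) /= => e2 e4 e6.
have c4 : u ^+ 4 * (1 - x' ^+ 4 + x' ^+ 8) = 1 - x ^+ 4 + x ^+ 8.
  transitivity ((u ^+ 2 * (1 + x' ^+ 4)) ^+ 2 - 3%:R * (u ^+ 4 * x' ^+ 4)); first by ring.
  by rewrite e2 e4; ring.
have dd : u ^+ 12 * (x' ^+ 8 * (1 - x' ^+ 4) ^+ 2) = x ^+ 8 * (1 - x ^+ 4) ^+ 2.
  transitivity ((u ^+ 4 * x' ^+ 4) ^+ 2 *
    ((u ^+ 2 * (1 + x' ^+ 4)) ^+ 2 - 4%:R * (u ^+ 4 * x' ^+ 4))); first by ring.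
  (* Both models have a6 = 0, so the translation [r] is the abscissa of a 2-torsion point. *)
  rewrite e2 e4; have : r * (r + 1) * (r + x ^+ 4) = 0 by rewrite [RHS]e6; ring.
  move/eqP; rewrite !mulf_eq0 -orbA => /or3P[/eqP->||]; first by ring.
    by rewrite addr_eq0 => /eqP ->; ring.
  by rewrite addr_eq0 => /eqP ->; ring.
by rewrite -dd -c4; ring.
Qed.

(** For |a| < 1 both 1 - a^4 and 1 - a^4 + a^8 are units, so |j| = |2|^8 / |a|^8 determines
    |a|^8. *)
Lemma legendre_isom_veq (K : fieldType) (O : set K) (L : fieldType)
    (iota : {rmorphism K -> L}) (a a' : K) :
  valuation_ring_over2 O -> (forall n : nat, n.+1%:R != 0 :> K) ->
  vlt O a 1 -> vlt O a' 1 ->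
  weierstrass_isom (map_weierstrass iota (legendre a))
                   (map_weierstrass iota (legendre a')) ->
  veq O (a ^+ 8) (a' ^+ 8).
Proof.
move=> VO K0 a1 a1' iso; have L2 : 2%:R != 0 :> L.
  by rewrite -(rmorph_nat iota) fmorph_eq0; apply: K0.
have unit x : vlt O x 1 -> veq O (1 - x ^+ 4) 1 /\ veq O (1 - x ^+ 4 + x ^+ 8) 1.
  move=> x1; have v4 := @vlt1X _ _ VO 3 _ x1; have v8 := @vlt1X _ _ VO 7 _ x1.
  split; first by apply: (veq1D VO); apply: vlt_opp.
  rewrite -addrA; apply: (veq1D VO) => le.
  have [h|h] := vle_total VO (x ^+ 8) (- x ^+ 4).
    case: (vlt_opp VO v4); apply: (vle_trans VO) le _.
    by apply: (vle_add VO) (vle_refl VO _) h.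
  by case: v8; apply: (vle_trans VO) le _; apply: (vle_add VO) h (vle_refl VO _).
have [u4 u8] := unit a a1; have [u4' u8'] := unit a' a1'.
have side x y : veq O (1 - x ^+ 4 + x ^+ 8) 1 -> veq O (1 - y ^+ 4) 1 ->
    veq O ((1 - x ^+ 4 + x ^+ 8) ^+ 3 * (y ^+ 8 * (1 - y ^+ 4) ^+ 2)) (y ^+ 8).
  move=> ux uy; rewrite -[X in veq _ _ X]mul1r.
  apply: (veq_mul VO); first by rewrite -[X in veq _ _ X](expr1n K 3); apply: veq_exp.
  rewrite -[X in veq _ _ X]mulr1; apply: (veq_mul VO) (veq_refl VO _) _.
  by rewrite -[X in veq _ _ X](expr1n K 2); apply: veq_exp.
apply: (veq_trans VO) (veq_sym (side a' a u8' u4)) _.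
by rewrite (legendre_isom L2 iso); apply: side.
Qed.

Theorem theorem19 (K : fieldExtType rat) (hK : \dim {:K} = 4%N)
    (Kbar : closedFieldType) (iota : {rmorphism K -> Kbar})
    (hKbar : integralRange iota) :
  ~ (exists n : nat, (0 < n)%N /\
       (geom_isom_classes iota (fun E : ellcurve K => embeds_in_points ('Z_4 * 'Z_8)%type E)
          #= `I_n)%card).
Proof.
case=> n [n0 Sn]; set S := geom_isom_classes _ _ in Sn.
have K0 := natr_neq0 K; have K2 : 2%:R != 0 :> K := K0 1%N.
have [S0|[_ [E0 emb0 _]]] : S = set0 \/ exists C, S C.
  have [|/existsNP [C /contrapT SC]] := pselect (forall C, ~ S C); last by right; exists C.
  by move=> nS; left; rewrite -subset0 => C /nS.
  by move: Sn; rewrite S0 card_eq_sym card_eq0 => /eqP In0; rewrite -[False]/(set0 0%N) -In0.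
have [[p np] [i ei]] := embed_noncusp K2 emb0.
have [O VO] := exists_valuation_ring K0.
have no8 t : ~ veq O (t ^+ 8) 2%:R by apply: no_eighth_root2; rewrite ?hK.
have [q qP] := noncusp_orbit K0 VO no8 np.
have /choice [E EP] k : exists E : ellcurve K,
    embeds_in_points ('Z_4 * 'Z_8)%type E /\ ec_weierstrass E = legendre (q k).1.1.
  have [nq _ _] := qP k; case: (q k) nq => [[a b] c] nq.
  by have [E emb eE] := embeds_legendre iota K2 nq ei; exists E.
pose C k := [set E' | geom_isom iota (E k) E']%classic.
have decr k l : (k < l)%N -> vlt O (q l).1.1 (q k).1.1.
  elim: l => // l IH; rewrite ltnS leq_eqVlt => /orP[/eqP->|/IH].
    by have [] := qP l.
  by apply: (vlt_trans VO); have [] := qP l.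
have Clt k l : (k < l)%N -> C k <> C l.
  move=> kl eC; have : C l (E l).
    rewrite /C /= /geom_isom; case: (map_weierstrass _ _) => a1 a2 a3 a4 a6.
    by exists 1, 0, 0, 0; split; [exact: oner_neq0|split; ring].
  rewrite -eC /C /= /geom_isom (proj2 (EP k)) (proj2 (EP l)) => iso.
  have [_ k1 _] := qP k; have [_ l1 _] := qP l.
  have [le _] := legendre_isom_veq VO K0 k1 l1 iso.
  have := vlt_sqr VO (vlt_sqr VO (vlt_sqr VO (decr _ _ kl))); rewrite -!exprM; exact.
have Cinj : injective C.
  by move=> k l eC; case: (ltngtP k l) => // [/Clt|/Clt /nesym]; case.
(* All classes [C k] lie in [S], so injectivity of [C] would make nat a finite preimage. *)
apply: infinite_nat; have -> : [set: nat]%classic = (C @^-1` S)%classic.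
  by apply/esym/seteqP; split=> // k _; exists (E k) => //; case: (EP k).
by apply: finite_preimage; [move=> k l _ _ /Cinj|exists n].
Qed.
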